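(* Let $[X,d,m]$ be a metric random walk space with invariant and reversible measure $\nu$. (1) The space is $m$-connected if and only if for every $0\le u_0\in L^2(X,\nu)$ that is not $\nu$-a.e. zero, $e^{t\Delta_m}u_0>0$ $\nu$-a.e. for all $t>0$. (2) The space is weakly-$m$-connected if and only if for every $0\le u_0\in L^2(X,\nu)\cap C(X)$ that is not $\nu$-a.e. zero, $e^{t\Delta_m}u_0>0$ $\nu$-a.e. for all $t>0$.
   Context: A metric random walk space $[X,d,m]$ is a Polish metric space $(X,d)$ with a family $m=(m_x)_{x\in X}$ of Borel probability measures, $x\mapsto m_x(A)$ Borel measurable for each Borel $A$, each with finite first moment. A Radon measure $\nu$ is invariant if $\nu(A)=\int_X m_x(A)\,d\nu(x)$ for every $\nu$-measurable $A$, reversible if $dm_x(y)d\nu(x)=dm_y(x)d\nu(y)$; $(X,\nu)$ is $\sigma$-finite. Iterates: $m_x^{*1}=m_x$, $m_x^{*n}(A)=\int_X m_z(A)\,dm_x^{*(n-1)}(z)$. For $\nu$-measurable $D$, $N^m_D=\{x: m_x^{*n}(D)=0\ \forall n\in\mathbb N\}$. The space (with $\nu$) is $m$-connected if $\nu(N^m_D)=0$ for every $\nu$-measurable $D$ with $0<\nu(D)<\infty$, and weakly-$m$-connected if $\nu(N^m_D)=0$ for every open $D$ with $0<\nu(D)<\infty$. The heat flow $(e^{t\Delta_m})_{t\ge0}$ is the semigroup on $L^2(X,\nu)$ generated by $\Delta_m f(x)=\int_X (f(y)-f(x))dm_x(y)$ (with domain $L^1\cap L^2$), i.e. the semigroup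 associated with the closed form $\mathcal E_m(f,g)=\frac12\iint (f(y)-f(x))(g(y)-g(x))\,dm_x(y)d\nu(x)$. *)

(* Defs.v *)
From HB Require Import structures.
From mathcomp Require Import all_boot all_order all_algebra.
From mathcomp Require Import all_classical all_reals all_analysis.
Set Implicit Arguments. Unset Strict Implicit. Unset Printing Implicit Defensive.
Import Order.TTheory GRing.Theory Num.Theory.
Local Open Scope classical_set_scope.
Local Open Scope ring_scope.

Section metric_rw_space.
Context {R : realType} {d : measure_display} {X : measurableType d}.
Implicit Types (dist : X -> X -> R).

Definition is_metric dist :=
  [/\ forall x y, 0 <= dist x y,
      forall x y, dist x y = 0 <-> x = y,
      forall x y, dist x y = dist y x &
      forall x y z, dist x z <= dist x y + dist y z].

Definition dball dist (x : X) (e : R) : set X := [set y | dist x y < e].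

Definition dopen dist (A : set X) : Prop :=
  forall x, A x -> exists2 e : R, 0 < e & dball dist x e `<=` A.

Definition dcauchy dist (u : nat -> X) : Prop :=
  forall e : R, 0 < e -> exists N, forall n k, (N <= n)%N -> (N <= k)%N ->
    dist (u n) (u k) < e.

Definition dconverges dist (u : nat -> X) (l : X) : Prop :=
  forall e : R, 0 < e -> exists N, forall n, (N <= n)%N -> dist (u n) l < e.

Definition dcomplete dist : Prop :=
  forall u, dcauchy dist u -> exists l, dconverges dist u l.

Definition dseparable dist : Prop :=
  exists S : set X, countable S /\
    forall x (e : R), 0 < e -> exists2 y, S y & dist x y < e.

Definition polish dist := [/\ is_metric dist, dcomplete dist & dseparable dist].

Definition borel_of dist : Prop :=
  (@measurable d X) = <<s dopen dist >>.

(* sequential compactness (= compactness in metric spaces) *)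
Definition dcompact dist (K : set X) : Prop :=
  forall u : nat -> X, (forall n, K (u n)) ->
    exists (phi : nat -> nat) (l : X), K l /\ {homo phi : n k / (n < k)%N} /\
      dconverges dist (u \o phi) l.

Definition dcontinuous dist (f : X -> R) : Prop :=
  forall x (e : R), 0 < e -> exists2 del : R, 0 < del &
    forall y, dist x y < del -> `|f y - f x| < e.

Definition radon dist (nu : {measure set X -> \bar R}) : Prop :=
  (forall x, exists2 e : R, 0 < e & (nu (dball dist x e) < +oo)%E) /\
  (forall A, measurable A ->
     nu A = ereal_sup [set nu K | K in [set K | dcompact dist K /\ K `<=` A]]).

Definition finite_first_moment dist (m : R.-pker X ~> X) : Prop :=
  forall x, (\int[m x]_y (dist x y)%:E < +oo)%E.

Definition metric_rw_space dist (m : R.-pker X ~> X) : Prop :=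
  [/\ polish dist, borel_of dist & finite_first_moment dist m].

Definition invariant_measure (m : R.-pker X ~> X) (nu : {measure set X -> \bar R}) :=
  forall A, measurable A -> nu A = (\int[nu]_x m x A)%E.

Definition reversible_measure (m : R.-pker X ~> X) (nu : {measure set X -> \bar R}) :=
  forall A B, measurable A -> measurable B ->
    (\int[nu]_(x in A) m x B)%E = (\int[nu]_(x in B) m x A)%E.

(* iterates: mstar m n = m^{*(n+1)} *)
Fixpoint mstar (m : R.-pker X ~> X) (n : nat) (x : X) (A : set X) : \bar R :=
  match n with
  | O => m x A
  | S k => integral (mstar m k x) setT (fun z => m z A)
  end.

Definition NmD (m : R.-pker X ~> X) (D : set X) : set X :=
  [set x | forall n, mstar m n x D = 0%E].

Definition m_connected (m : R.-pker X ~> X) (nu : {measure set X -> \bar R}) :=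
  forall D, measurable D -> (0 < nu D)%E -> (nu D < +oo)%E -> nu (NmD m D) = 0%E.

Definition weakly_m_connected dist (m : R.-pker X ~> X)
    (nu : {measure set X -> \bar R}) :=
  forall D, dopen dist D -> (0 < nu D)%E -> (nu D < +oo)%E ->
    nu (NmD m D) = 0%E.

Definition L2 (nu : {measure set X -> \bar R}) (f : X -> R) : Prop :=
  measurable_fun setT f /\ nu.-integrable setT (fun x => ((f x) ^+ 2)%:E).

Definition lapl (m : R.-pker X ~> X) (f : X -> R) (x : X) : R :=
  Rintegral (m x) setT (fun y => f y - f x).

(* u : [0,oo) -> L^2 is the heat flow e^{t Delta_m} u0: the (unique)
   L^2-differentiable solution of u' = Delta_m u, u(0) = u0 *)
Definition is_heat_flow (m : R.-pker X ~> X) (nu : {measure set X -> \bar R})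
    (u0 : X -> R) (u : R -> X -> R) : Prop :=
  [/\ forall t, 0 <= t -> L2 nu (u t),
      {ae nu, forall x, u 0 x = u0 x} &
      forall t, 0 <= t -> forall e : R, 0 < e -> exists2 del : R, 0 < del &
        forall h : R, h != 0 -> `|h| < del -> 0 <= t + h ->
          (\int[nu]_x ((((u (t + h) x - u t x) / h - lapl m (u t) x) ^+ 2)%:E)
            <= e%:E)%E].

Definition heat_positivity (m : R.-pker X ~> X) (nu : {measure set X -> \bar R})
    (P : (X -> R) -> Prop) : Prop :=
  forall u0, L2 nu u0 -> P u0 -> {ae nu, forall x, 0 <= u0 x} ->
    ~ {ae nu, forall x, u0 x = 0} ->
    forall u, is_heat_flow m nu u0 u ->
    forall t, 0 < t -> {ae nu, forall x, 0 < u t x}.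

End metric_rw_space.

(* Main.v *)
(** The averaging operator M f(x) = int f dm_x is symmetric on L^2(nu) and
    Delta_m = M - 1, so the heat flow is e^{-t} sum_n t^n/n! M^n u0, a sum of
    nonnegative terms when u0 >= 0.  Its value at x is positive as soon as some
    m_x^{*n} charges a superlevel set D = {u0 > c}, i.e. for x outside the set
    of points from which D cannot be reached.

    An arbitrary L^2 solution u is compared with this series by duality rather
    than by uniqueness: for a set B of finite measure the numbers
    phi_n(t) = <u(t), M^n 1_B> satisfy phi_n' = phi_{n+1} - phi_n and are
    bounded uniformly in n on [0,T], so a Taylor expansion of e^t phi_0 gives
    e^t <u(t), 1_B> >= t^n/n! <u0, M^n 1_B> for every n.  If u(t) <= 0 on B, all
    <u0, M^n 1_B> vanish; by symmetry m_x^{*n}(D) = 0 for almost every x in B and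
    every n, whence nu(B) = 0.

    Conversely, the series started from a function g with 0 < g <= 1 on D and
    g = 0 outside D (an indicator, or a continuous cutoff when D is open) is a
    heat flow vanishing on the points outside D from which D cannot be reached;
    those inside D always form a null set. *)

Require Import Defs.
From HB Require Import structures.
From mathcomp Require Import all_boot all_order all_algebra.
From mathcomp Require Import finmap.
From mathcomp Require Import all_classical all_reals all_analysis.
From mathcomp Require Import measurable_realfun simple_functions.
From mathcomp Require Import measurable_fun_approximation.
From mathcomp Require Import ring lra.
Set Implicit Arguments. Unset Strict Implicit. Unset Printing Implicit Defensive.
Import Order.TTheory GRing.Theory Num.Theory.
Import numFieldNormedType.Exports.
Local Open Scope classical_set_scope.
Local Open Scope ring_scope.

(** * Functionals on nonnegative measurable functions *)

Section nonneg_functionals.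
Context {R : realType} {d : measure_display} {X : measurableType d}.
Local Open Scope ereal_scope.

Definition nnmeas (f : X -> \bar R) :=
  measurable_fun [set: X] f /\ (forall x, 0 <= f x).

(** The first three clauses drive the standard machine; positivity and monotonicity make the class
    closed under integration over a parameter ([nnlin_int]), where monotone convergence is applied
    to [T (F n)]. *)
Definition nnlin (I : (X -> \bar R) -> \bar R) :=
  [/\ forall f g, nnmeas f -> nnmeas g -> I (f \+ g) = I f + I g,
      forall (c : R) f, (0 <= c)%R -> nnmeas f ->
        I (fun x => c%:E * f x) = c%:E * I f,
      forall (F : nat -> X -> \bar R) f, (forall n, nnmeas (F n)) -> nnmeas f ->
        (forall x, {homo F ^~ x : n k / (n <= k)%N >-> n <= k}) ->
        (forall x, F n x @[n --> \oo] --> f x) -> I (F n) @[n --> \oo] --> I f,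
      forall f, nnmeas f -> 0 <= I f &
      forall f g, nnmeas f -> nnmeas g -> (forall x, f x <= g x) -> I f <= I g].

Lemma nnmeasD f g : nnmeas f -> nnmeas g -> nnmeas (f \+ g).
Proof.
move=> [mf f0] [mg g0]; split; first exact: emeasurable_funD.
by move=> x; rewrite adde_ge0.
Qed.

Lemma nnmeasZ (c : R) f : (0 <= c)%R -> nnmeas f -> nnmeas (fun x => c%:E * f x).
Proof.
move=> c0 [mf f0]; split; first exact: measurable_funeM.
by move=> x; rewrite mule_ge0.
Qed.

Lemma nnmeasM f g : nnmeas f -> nnmeas g -> nnmeas (fun x => f x * g x).
Proof.
move=> [mf f0] [mg g0]; split; first exact: emeasurable_funM.
by move=> x; rewrite mule_ge0.
Qed.

Lemma nnmeas_indic A : measurable A -> nnmeas (EFin \o \1_A).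
Proof.
move=> mA; split; last by move=> x; rewrite lee_fin.
by apply/measurable_EFinP; exact: measurable_indic.
Qed.

Import HBNNSimple.

Lemma nnmeas_nnsfun (f : {nnsfun X >-> R}) : nnmeas (EFin \o f).
Proof.
by split; [apply/measurable_EFinP|move=> x; rewrite lee_fin].
Qed.

(* The standard machine: indicators, simple functions, monotone limits. *)
Lemma nnlin_ext I J : nnlin I -> nnlin J ->
  (forall A, measurable A -> I (EFin \o \1_A) = J (EFin \o \1_A)) ->
  forall f, nnmeas f -> I f = J f.
Proof.
move=> [ID IZ Icvg I0 Ile] [JD JZ Jcvg J0 Jle] IJ f nf.
have IJs (g : {nnsfun X >-> R}) : I (EFin \o g) = J (EFin \o g).
  (* In the extended reals additivity does not force I 0 = 0; homogeneity with factor 0 does. *)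
  have zE : (fun x : X => (0%R : R)%:E * (EFin \o \1_(@set0 X)) x) = EFin \o cst 0%R.
    by apply/funext => x /=; rewrite mul0e.
  have nz : nnmeas (EFin \o \1_(@set0 X)) by exact: nnmeas_indic.
  have IJ0 : I (EFin \o cst 0%R) = J (EFin \o cst 0%R).
    by rewrite -zE IZ// JZ// !mul0e.
  have gE : EFin \o g =
      (fun x => \sum_(r <- fset_set (range g)) (r * \1_(g @^-1` [set r]) x)%:E).
    apply/funext => x /=; rewrite fimfunE -fsumEFin// fsbig_finite//.
  rewrite gE.
  have sub : forall r, r \in (fset_set (range g) : seq R) -> (0 <= r)%R.
    move=> r; rewrite in_fset_set// inE => -[x _ <-]; exact: fun_ge0.
  suff : nnmeas (fun x => \sum_(r <- fset_set (range g)) (r * \1_(g @^-1` [set r]) x)%:E) /\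
    I (fun x => \sum_(r <- fset_set (range g)) (r * \1_(g @^-1` [set r]) x)%:E) =
    J (fun x => \sum_(r <- fset_set (range g)) (r * \1_(g @^-1` [set r]) x)%:E) by case.
  elim: (fset_set (range g) : seq R) sub => [_|r s ih sub].
    under eq_fun do rewrite big_nil.
    by split => //; rewrite -zE; apply: nnmeasZ.
  under eq_fun do rewrite big_cons.
  have [|ns Is] := ih; first by move=> q qs; apply: sub; rewrite inE qs orbT.
  have r0 : (0 <= r)%R by apply: sub; rewrite inE eqxx.
  have nI : nnmeas (EFin \o \1_(g @^-1` [set r])) by exact: nnmeas_indic.
  have nr : nnmeas (fun x => (r * \1_(g @^-1` [set r]) x)%:E).
    by under eq_fun do rewrite EFinM; exact: (nnmeasZ r0 nI).
  split; first exact: (nnmeasD nr ns).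
  rewrite (ID _ _ nr ns) (JD _ _ nr ns) Is; congr (_ + _).
  under eq_fun do rewrite EFinM.
  by rewrite (IZ _ _ r0 nI) (JZ _ _ r0 nI) IJ.
have [mf f0] := nf.
pose f_ n := EFin \o nnsfun_approx measurableT mf n.
have nf_ n : nnmeas (f_ n) by exact: nnmeas_nnsfun.
have ndf : forall x, {homo f_ ^~ x : n k / (n <= k)%N >-> n <= k}.
  by move=> x n k nk; rewrite lee_fin; exact/lefP/nd_nnsfun_approx.
have cvf x : f_ n x @[n --> \oo] --> f x by exact: cvg_nnsfun_approx.
have cI := Icvg _ _ nf_ nf ndf cvf.
have cJ := Jcvg _ _ nf_ nf ndf cvf.
rewrite -(cvg_lim _ cI)// -(cvg_lim _ cJ)//.
by congr (limn _); apply/funext => n; exact: IJs.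
Qed.

Lemma nnlin_eval x : nnlin (fun f => f x).
Proof. by split => // f [_]. Qed.

Lemma nnlin_Mr I c : nnlin I -> 0 <= c -> c \is a fin_num ->
  nnlin (fun f => I f * c).
Proof.
move=> [ID IZ Icvg I0 Ile] c0 cf; split.
- by move=> f g nf ng; rewrite ID// ge0_muleDl// I0.
- by move=> k f k0 nf; rewrite IZ// muleA.
- move=> F f nF nf ndF cF; have := Icvg _ _ nF nf ndF cF.
  by move/(cvgeZr cf).
- by move=> f nf; rewrite mule_ge0// I0.
- by move=> f g nf ng fg; rewrite lee_wpmul2r// Ile.
Qed.

Lemma nnlin_int {d'} {Y : measurableType d'} (mu : {measure set Y -> \bar R})
    (T : (X -> \bar R) -> Y -> \bar R) :
  (forall y, nnlin (T ^~ y)) ->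
  (forall f, nnmeas f -> measurable_fun setT (T f)) ->
  nnlin (fun f => \int[mu]_y T f y).
Proof.
move=> lT mT.
have T0 f y : nnmeas f -> 0 <= T f y by case: (lT y) => _ _ _ + _; exact.
split.
- move=> f g nf ng; rewrite -ge0_integralD//; last 4 first.
  + by move=> y _; exact: T0.
  + exact: mT.
  + by move=> y _; exact: T0.
  + exact: mT.
  by apply: eq_integral => y _; case: (lT y) => -> .
- move=> c f c0 nf; rewrite -ge0_integralZl//; last 2 first.
  + exact: mT.
  + by move=> y _; exact: T0.
  by apply: eq_integral => y _; case: (lT y) => _ ->.
- move=> F f nF nf ndF cF.
  have -> : \int[mu]_y T f y = \int[mu]_y limn (fun n => T (F n) y).
    apply: eq_integral => y _; apply/esym/cvg_lim => //.
    by case: (lT y) => _ _ + _ _; apply.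
  apply: cvg_monotone_convergence => //.
  + by move=> n; apply: mT.
  + by move=> n y _; exact: T0.
  + move=> y _ n k nk; case: (lT y) => _ _ _ _; apply => // x.
    exact: ndF.
- by move=> f nf; apply: integral_ge0 => y _; exact: T0.
- move=> f g nf ng fg; apply: ge0_le_integral => //.
  + by move=> y _; exact: T0.
  + exact: mT.
  + exact: mT.
  + by move=> y _; case: (lT y) => _ _ _ _; apply.
Qed.

Lemma nnlin_integral (mu : {measure set X -> \bar R}) :
  nnlin (fun f => \int[mu]_y f y).
Proof. by apply: (@nnlin_int _ X mu id) => [|f []]; first exact: nnlin_eval. Qed.

End nonneg_functionals.

(** * The averaging operator *)

Section averaging.
Context {R : realType} {d : measure_display} {X : measurableType d}.
Local Open Scope ereal_scope.

Definition avg (k : X -> {measure set X -> \bar R}) (f : X -> \bar R) : X -> \bar R :=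
  fun x => \int[k x]_y f y.

Lemma nnlin_avg (k : X -> {measure set X -> \bar R}) x : nnlin (avg k ^~ x).
Proof. exact: nnlin_integral. Qed.

Section kernel.
Variable k : R.-ker X ~> X.

Lemma nnmeas_avg f : nnmeas f -> nnmeas (avg k f).
Proof.
move=> [mf f0]; split; last by move=> x; exact: integral_ge0.
by apply: measurable_fun_integral_kernel => // U mU; exact: measurable_kernel.
Qed.

Lemma nnmeas_iter_avg n f : nnmeas f -> nnmeas (iter n (avg k) f).
Proof. by move=> nf; elim: n => //= n; exact: nnmeas_avg. Qed.

Lemma avg_indic A x : measurable A -> avg k (EFin \o \1_A) x = k x A.
Proof. by move=> mA; rewrite /avg integral_indic// setIT. Qed.

Lemma le_iter_avg n f g : nnmeas f -> nnmeas g -> (forall x, f x <= g x) ->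
  forall x, iter n (avg k) f x <= iter n (avg k) g x.
Proof.
move=> nf ng fg; elim: n => //= n ih x.
by case: (nnlin_avg k x) => _ _ _ _; apply => //; exact: nnmeas_iter_avg.
Qed.

End kernel.

Variable m : R.-pker X ~> X.

Lemma iter_avg_le1 n f : nnmeas f -> (forall x, f x <= 1) ->
  forall x, iter n (avg m) f x <= 1.
Proof.
move=> nf f1; elim: n => //= n ih x.
apply: (@le_trans _ _ (\int[m x]_y (cst 1 y))).
  by apply: ge0_le_integral => //; case: (nnmeas_iter_avg m n nf).
by rewrite integral_cst// mul1e; rewrite prob_kernel.
Qed.

(** [mstar m n x] is only a set function; realising it as a kernel allows integration against it.
    Since [mstar m n] is [m^{*(n+1)}], the operator is iterated [n.+1] times. *)
Lemma mstar_kernel n : exists k : R.-spker X ~> X,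
  (forall x, (k x : set X -> \bar R) = mstar m n x) /\
  (forall f x, nnmeas f -> avg k f x = iter n.+1 (avg m) f x).
Proof.
elim: n => [|n [k [km kf]]].
  by exists m.
exists (mkcomp_noparam k m); split => [x|f x nf].
  by apply/funext => A; rewrite /= -km.
(* The new factor [m] of [mstar] is the innermost average, so the iterate is peeled from the
   right. *)
rewrite iterSr -kf; last exact: nnmeas_avg.
apply: (nnlin_ext (I := fun f => avg (mkcomp_noparam k m) f x)
  (J := fun f => avg k (avg m f) x)) => //.
- exact: nnlin_avg.
- apply: nnlin_int => [y|g ng]; first exact: nnlin_avg.
  by case: (nnmeas_avg m ng).
- move=> A mA; rewrite /avg integral_indic// setIT.
  by apply: eq_integral => y _; rewrite integral_indic// setIT.
Qed.

Lemma mstarE n x A : measurable A ->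
  mstar m n x A = iter n.+1 (avg m) (EFin \o \1_A) x.
Proof.
move=> mA; have [k [km kf]] := mstar_kernel n.
by rewrite -kf; [rewrite /avg integral_indic// setIT km | exact: nnmeas_indic].
Qed.

Variable nu : {measure set X -> \bar R}.
Hypothesis rev : reversible_measure m nu.

Lemma bounded_fin (f : X -> \bar R) : nnmeas f -> (forall x, f x <= 1) ->
  forall x, f x \is a fin_num.
Proof. by move=> [_ f0] f1 x; rewrite ge0_fin_numE// (le_lt_trans (f1 x))// ltry. Qed.

Lemma avg_adjoint f g : nnmeas f -> nnmeas g -> (forall x, g x <= 1) ->
  \int[nu]_x (avg m f x * g x) = \int[nu]_x (f x * avg m g x).
Proof.
move=> nf ng g1; have ngm := nnmeas_avg m ng.
have intIM A h : measurable A ->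
    \int[nu]_x ((EFin \o \1_A) x * h x) = \int[nu]_(x in A) h x.
  by move=> mA; rewrite [RHS]integral_mkcond; apply: eq_integral => x _;
    rewrite /= patchE indicE; case: ifPn; rewrite ?mul1e ?mul0e.
have stage1 A : measurable A ->
    \int[nu]_x (avg m (EFin \o \1_A) x * g x) =
    \int[nu]_x ((EFin \o \1_A) x * avg m g x).
  move=> mA.
  apply: (nnlin_ext (I := fun g => \int[nu]_x (avg m (EFin \o \1_A) x * g x))
    (J := fun g => \int[nu]_x ((EFin \o \1_A) x * avg m g x))) => //.
  - apply: (nnlin_int nu (T := fun g x => avg m (EFin \o \1_A) x * g x)).
      move=> y; under eq_fun do rewrite muleC.
      apply: nnlin_Mr; first exact: nnlin_eval.
        by case: (nnmeas_avg m (nnmeas_indic mA)) => _; apply.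
      apply: bounded_fin; first exact/nnmeas_avg/nnmeas_indic.
      apply: (@iter_avg_le1 1) => [|x]; first exact: nnmeas_indic.
      by rewrite lee_fin indicE; case: (_ \in _).
    by move=> h nh; case: (nnmeasM (nnmeas_avg m (nnmeas_indic mA)) nh).
  - apply: (nnlin_int nu (T := fun g x => (EFin \o \1_A) x * avg m g x)).
      move=> y; under eq_fun do rewrite muleC.
      by apply: nnlin_Mr; [exact: nnlin_avg | rewrite lee_fin |].
    by move=> h nh; case: (nnmeasM (nnmeas_indic mA) (nnmeas_avg m nh)).
  - move=> B mB; under eq_integral do rewrite muleC.
    rewrite !intIM//; under eq_integral do rewrite avg_indic//.
    by under [RHS]eq_integral do rewrite avg_indic//; rewrite rev.
apply: (nnlin_ext (I := fun f => \int[nu]_x (avg m f x * g x))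
  (J := fun f => \int[nu]_x (f x * avg m g x))) => //.
- apply: (nnlin_int nu (T := fun f x => avg m f x * g x)).
    move=> y; apply: nnlin_Mr; first exact: nnlin_avg.
      by case: ng.
    exact: bounded_fin.
  by move=> h nh; case: (nnmeasM (nnmeas_avg m nh) ng).
- apply: (nnlin_int nu (T := fun f x => f x * avg m g x)).
    move=> y; apply: nnlin_Mr; first exact: nnlin_eval.
      by case: ngm.
    by apply: bounded_fin => //; exact: (@iter_avg_le1 1).
  by move=> h nh; case: (nnmeasM nh ngm).
Qed.

Lemma iter_avg_adjoint n f g : nnmeas f -> nnmeas g -> (forall x, g x <= 1) ->
  \int[nu]_x (iter n (avg m) f x * g x) = \int[nu]_x (f x * iter n (avg m) g x).
Proof.
move=> nf; elim: n g => // n ih g ng g1.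
rewrite [in RHS]iterSr -ih; last 2 first.
- exact: nnmeas_avg.
- exact: (@iter_avg_le1 1).
by rewrite /= avg_adjoint//; exact: nnmeas_iter_avg.
Qed.

(** Adjointness against the constant 1, which M fixes because each [m x] is a probability. *)
Lemma integral_iter_avg n f : nnmeas f ->
  \int[nu]_x iter n (avg m) f x = \int[nu]_x f x.
Proof.
move=> nf; elim: n => //= n <-.
transitivity (\int[nu]_x (avg m (iter n (avg m) f) x * cst 1 x)).
  by apply: eq_integral => x _; rewrite mule1.
rewrite avg_adjoint; [|exact: nnmeas_iter_avg|by split|by []].
apply: eq_integral => x _.
by rewrite /avg integral_cst// prob_kernel mule1 mule1.
Qed.

End averaging.

(** * Poisson weights *)

Section calculus.
Context {R : realType}.
Implicit Types (f df ddf : R -> R).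

Lemma lipschitz_derive_bound f df (a b K : R) :
  (forall x : R, is_derive x 1 f (df x)) ->
  (forall x, a <= x <= b -> `|df x| <= K) ->
  forall x y, a <= x <= b -> a <= y <= b -> `|f y - f x| <= K * `|y - x|.
Proof.
move=> fd dfK x y.
wlog xy : x y / x <= y => [wl xab yab|].
  have [/wl|/ltW/wl] := leP x y; first exact.
  by rewrite distrC [X in _ <= _ * X]distrC; apply.
move=> xab yab.
have [|c + ->] := @MVT_segment R f df x y xy (fun z _ => fd z).
  by apply: derivable_within_continuous => z _; apply: ex_derive.
rewrite in_itv /= => /andP[xc cy].
by rewrite normrM ler_wpM2r// dfK//; lra.
Qed.

(** The mean value theorem is used twice, on [df] and on [f] minus its tangent slope at [t], which
    gives [K] in place of the sharp K/2. *)
Lemma taylor1_bound f df ddf (T K t h : R) :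
  (forall x : R, is_derive x 1 f (df x)) -> (forall x : R, is_derive x 1 df (ddf x)) ->
  (forall s, 0 <= s <= T -> `|ddf s| <= K) ->
  0 <= t <= T -> 0 <= t + h <= T ->
  `|f (t + h) - f t - h * df t| <= K * h ^+ 2.
Proof.
move=> fd dfd ddK tT thT.
have K0 : 0 <= K by apply: le_trans (ddK t tT).
pose g s := f s - s * df t.
have gd (x : R) : is_derive x 1 g (df x - df t).
  rewrite /g; have := fd x => ?.
  apply: is_derive_eq.
  by rewrite /GRing.scale /=; lra.
have lip := lipschitz_derive_bound dfd ddK.
(* The increment [h] may have either sign. *)
pose a := Num.min t (t + h); pose b := Num.max t (t + h).
have abT : 0 <= a /\ b <= T by rewrite /a /b le_min ge_max; split; lra.
have gb x : a <= x <= b -> `|df x - df t| <= K * `|h|.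
  move=> xab; apply: le_trans (lip t x _ _) _ => //; first by lra.
  rewrite ler_wpM2l//.
  move: xab; rewrite /a /b; have [h0|h0] := leP 0 h.
    rewrite min_l ?max_r; [|lra|lra].
    by move=> ?; rewrite !ger0_norm; lra.
  rewrite min_r ?max_l; [|lra|lra].
  by move=> ?; rewrite !ler0_norm; lra.
have -> : f (t + h) - f t - h * df t = g (t + h) - g t by rewrite /g; ring.
have -> : K * h ^+ 2 = K * `|h| * `|t + h - t|.
  by rewrite addrAC subrr add0r -mulrA -expr2 real_normK ?num_real.
apply: (lipschitz_derive_bound gd gb).
- by rewrite /a /b ge_min lexx le_max lexx.
- by rewrite /a /b ge_min lexx le_max lexx !orbT.
Qed.

(** On the coefficients t^n/n! this is differentiation in t; on the coefficients of a series in M^n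
    it is multiplication by M ([avg_avgs]). *)
Definition delay (a : R^nat) : R^nat := fun n => if n is k.+1 then a k else 0.

Lemma is_derive_exp_coeff n (t : R) :
  is_derive t 1 (fun s => exp_coeff s n) (delay (exp_coeff t) n).
Proof.
rewrite /exp_coeff/=; case: n => [|n] /=.
  by under eq_fun do rewrite expr0; exact: is_derive_cst.
rewrite (_ : (fun s => _) = n.+1`!%:R^-1 *: (id ^+ n.+1 : R -> R)); last first.
  by apply/funext => s; rewrite mulrC /GRing.scale /= fctE.
apply: is_derive_eq; rewrite /GRing.scale /= factS natrM mulr1 -mulr_natl.
field.
by rewrite nat1r !pnatr_eq0 -lt0n fact_gt0.
Qed.

(** The Poisson distribution of parameter [t]. *)
Definition pois (t : R) : R^nat := fun n => expR (- t) * exp_coeff t n.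

Lemma pois_ge0 t n : 0 <= t -> 0 <= pois t n.
Proof. by move=> t0; rewrite mulr_ge0 ?expR_ge0 ?exp_coeff_ge0. Qed.

Lemma is_derive_pois n (t : R) :
  is_derive t 1 (pois ^~ n) (delay (pois t) n - pois t n).
Proof.
have -> : delay (pois t) n = expR (- t) * delay (exp_coeff t) n.
  by case: n => [|n] /=; rewrite ?mulr0.
have := is_derive_exp_coeff n t => ?.
rewrite /pois; apply: is_derive_eq.
by rewrite /GRing.scale /=; ring.
Qed.

Lemma exp_coeff_le (s t : R) n : 0 <= s <= t -> exp_coeff s n <= exp_coeff t n.
Proof.
by move=> /andP[s0 st]; rewrite /exp_coeff ler_wpM2r ?invr_ge0// lerXn2r ?nnegrE ?(le_trans s0).
Qed.

(** Doubling [t] pays for an index shift, because n+1 <= 2^(n+1) and t^n <= t^(n+1). *)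
Lemma exp_coeff_leS (t : R) n : 1 <= t -> exp_coeff t n <= exp_coeff (2 * t) n.+1.
Proof.
move=> t1; rewrite /exp_coeff /= factS natrM invfM exprMn mulrA ler_wpM2r//.
have n0 : (0 : R) < n.+1%:R by rewrite ltr0n.
rewrite ler_pdivlMr// mulrC.
apply: ler_pM => //; first by rewrite exprn_ge0//; lra.
  by rewrite -natrX ler_nat ltnW// ltn_expl.
by rewrite exprS ler_peMl// exprn_ge0//; lra.
Qed.

Lemma pois_le_exp_coeff s t n : 0 <= s <= t -> pois s n <= exp_coeff t n.
Proof.
move=> st; have /andP[s0 _] := st; apply: le_trans (exp_coeff_le n st).
rewrite /pois ler_piMl ?exp_coeff_ge0//.
by rewrite -expR0 ler_expR; lra.
Qed.

(** The second time derivative is a second difference of the weights. Its two delays turn [T] into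
    [4 * T] by [exp_coeff_leS], so that one sequence, summable in [n], dominates all its terms. *)
Lemma pois_taylor (T t h : R) n : 1 <= T -> 0 <= t <= T -> 0 <= t + h <= T ->
  `|pois (t + h) n - pois t n - h * (delay (pois t) n - pois t n)|
    <= 4 * exp_coeff (4 * T) n * h ^+ 2.
Proof.
move=> T1 tT thT.
pose ddf s := delay (delay (pois s)) n - delay (pois s) n
   - (delay (pois s) n - pois s n).
have dd (s : R) : is_derive s 1 (fun s => delay (pois s) n - pois s n) (ddf s).
  have H := is_derive_pois n s.
  have H' : is_derive s 1 (fun s => delay (pois s) n)
      (delay (delay (pois s)) n - delay (pois s) n).
    case: n {ddf H} => [|n] /=; last exact: is_derive_pois.
    by rewrite subr0; exact: is_derive_cst.
  by rewrite /ddf; apply: is_deriveB.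
apply: (@taylor1_bound (pois ^~ n) (fun s => delay (pois s) n - pois s n) ddf T
  (4 * exp_coeff (4 * T) n) t h) => //.
  by move=> s; exact: is_derive_pois.
move=> s sT.
have p0 k : 0 <= pois s k by apply: pois_ge0; lra.
have p1 k : pois s k <= exp_coeff T k by apply: pois_le_exp_coeff.
have T4 : 1 <= 2 * T by lra.
have e4 k (r : R) : 1 <= r <= 4 * T -> exp_coeff r k <= exp_coeff (4 * T) k.
  by move=> ?; apply: exp_coeff_le; lra.
have q0 : 0 <= delay (pois s) n <= exp_coeff (4 * T) n.
  case: n {ddf dd} => [|n] /=; first by rewrite lexx exp_coeff_ge0//; lra.
  rewrite p0 (le_trans (p1 _))// (le_trans (exp_coeff_leS n T1))// e4//; lra.
have r0 : 0 <= delay (delay (pois s)) n <= exp_coeff (4 * T) n.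
  case: n {ddf dd q0} => [|[|n]] /=; try by rewrite lexx exp_coeff_ge0//; lra.
  rewrite p0 (le_trans (p1 _))// (le_trans (exp_coeff_leS n T1))//.
  rewrite (le_trans (exp_coeff_leS n.+1 T4))//.
  by rewrite (_ : 2 * (2 * T) = 4 * T)//; lra.
have s0 : 0 <= pois s n <= exp_coeff (4 * T) n.
  by rewrite p0 (le_trans (p1 _))// e4//; lra.
by rewrite /ddf ler_norml; lra.
Qed.

End calculus.

(** * Nonnegative sequences with bounded partial sums *)

Section bounded_sums.
Context {R : realType}.

(** Summability with an explicit bound: since M^n f <= 1, [C] also bounds the series with
    coefficients [a] pointwise. *)
Definition psum (a : R^nat) (C : R) :=
  (forall n, 0 <= a n) /\ (forall N, \sum_(0 <= n < N) a n <= C).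

Lemma psum_bound_ge0 a C : psum a C -> 0 <= C.
Proof. by move=> [_ /(_ 0%N)]; rewrite big_nil. Qed.

Lemma psum_delay a C : psum a C -> psum (delay a) C.
Proof.
move=> aC; have C0 := psum_bound_ge0 aC; case: aC => a0 aC; split => [[|n]//=|[|N]].
  by rewrite big_nil.
by rewrite big_nat_recl//= add0r.
Qed.

Lemma psumZ c a C : 0 <= c -> psum a C -> psum (fun n => c * a n) (c * C).
Proof.
move=> c0 [a0 aC]; split=> [n|N]; first by rewrite mulr_ge0.
by rewrite -mulr_sumr ler_wpM2l.
Qed.

Lemma le_psum a b C : (forall n, 0 <= b n <= a n) -> psum a C -> psum b C.
Proof.
move=> ba [a0 aC]; split=> [n|N]; first by case/andP: (ba n).
by apply: le_trans (aC N); apply: ler_sum => n _; case/andP: (ba n).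
Qed.

Lemma psum_exp_coeff (t : R) : 0 <= t -> psum (exp_coeff t) (expR t).
Proof.
move=> t0; split=> [n|N]; first exact: exp_coeff_ge0.
apply: (@nondecreasing_cvgn_le _ (series (exp_coeff t))) => //.
  by apply: nondecreasing_series => n _ _; exact: exp_coeff_ge0.
exact: is_cvg_series_exp_coeff.
Qed.

Lemma psum_pois (t : R) : 0 <= t -> psum (pois t) (expR t).
Proof.
move=> t0; apply: le_psum (psum_exp_coeff t0) => n.
by rewrite pois_ge0//= pois_le_exp_coeff// t0 lexx.
Qed.

End bounded_sums.

(** * Series in the powers of the averaging operator *)

Section avg_series.
Context {R : realType} {d : measure_display} {X : measurableType d}.
Variables (m : R.-pker X ~> X) (nu : {measure set X -> \bar R}).
Hypothesis rev : reversible_measure m nu.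
Variable f : X -> \bar R.
Hypotheses (nf : nnmeas f) (f1 : forall x, (f x <= 1)%E).

Local Notation F n := (iter n (avg m) f).

(** Extended values permit termwise integration; under [psum] the sum is finite and [fine] loses
    nothing ([avgsK]). *)
Definition avgs (a : R^nat) (x : X) : \bar R :=
  (\sum_(n <oo) ((a n)%:E * F n x))%E.

Let nF n : nnmeas (F n). Proof. exact: nnmeas_iter_avg. Qed.
Let F0 n x : (0 <= F n x)%E. Proof. by case: (nF n). Qed.
Let F1 n x : (F n x <= 1)%E. Proof. exact: iter_avg_le1. Qed.
Let Ffin n x : F n x \is a fin_num. Proof. exact: bounded_fin. Qed.

Section fixed.
Variables (a : R^nat) (C : R).
Hypothesis aC : psum a C.
Let a0 n : 0 <= a n. Proof. by case: aC. Qed.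
Let t0 n x : (0 <= (a n)%:E * F n x)%E. Proof. by rewrite mule_ge0// lee_fin. Qed.

Lemma nnmeas_avgs : nnmeas (avgs a).
Proof.
split; last by move=> x; apply: nneseries_ge0.
apply: ge0_emeasurable_sum => [n x _ _|n _]; first exact: t0.
by apply: measurable_funeM; case: (nF n).
Qed.

Lemma avgs_le x : (avgs a x <= C%:E)%E.
Proof.
apply: lime_le; first by apply: is_cvg_nneseries => n _ _; exact: t0.
apply: nearW => N; apply: (@le_trans _ _ (\sum_(0 <= n < N) (a n)%:E)%E).
  apply: lee_sum => n _; rewrite -[leRHS]mule1 lee_wpmul2l//.
  by rewrite lee_fin.
by rewrite sumEFin lee_fin; case: aC.
Qed.

Lemma avgs_fin x : avgs a x \is a fin_num.
Proof.
rewrite ge0_fin_numE; last by case: nnmeas_avgs.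
by rewrite (le_lt_trans (avgs_le x))// ltry.
Qed.

Lemma avgsK x : (fine (avgs a x))%:E = avgs a x.
Proof. by rewrite fineK// avgs_fin. Qed.

Lemma fine_avgs_ge0 x : 0 <= fine (avgs a x).
Proof. by rewrite fine_ge0//; case: nnmeas_avgs. Qed.

Lemma fine_avgs_le x : fine (avgs a x) <= C.
Proof. by rewrite -lee_fin avgsK avgs_le. Qed.

Lemma measurable_fine_avgs : measurable_fun [set: X] (fun x => fine (avgs a x)).
Proof. by apply: measurableT_comp => //; case: nnmeas_avgs. Qed.

(** Real partial sums allow signed combinations of several series to be compared term by term. *)
Lemma avgs_cvg x :
  \sum_(0 <= n < N) (a n * fine (F n x)) @[N --> \oo] --> fine (avgs a x).
Proof.
rewrite (_ : (fun N => _) =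
    fine \o (fun N => (\sum_(0 <= n < N) ((a n)%:E * F n x))%E)); last first.
  apply/funext => N /=.
  under [in RHS]eq_bigr => n _ do rewrite -[F n x]fineK// -EFinM.
  by rewrite sumEFin.
apply: fine_cvg; rewrite avgsK.
by apply: is_cvg_nneseries => n _ _; exact: t0.
Qed.

Lemma integral_avgs : (\int[nu]_x avgs a x <= C%:E * \int[nu]_x f x)%E.
Proof.
rewrite integral_nneseries//; last first.
  by move=> n; apply: measurable_funeM; case: (nF n).
have -> : (\sum_(n <oo) \int[nu]_x ((a n)%:E * F n x) =
    \sum_(n <oo) ((a n)%:E * \int[nu]_x f x))%E.
  apply: eq_eseriesr => n _; rewrite ge0_integralZl ?lee_fin//; last by case: (nF n).
  by rewrite (integral_iter_avg rev).
have I0 : (0 <= \int[nu]_x f x)%E by apply: integral_ge0; case: nf.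
apply: lime_le.
  by apply: is_cvg_nneseries => n _ _; rewrite mule_ge0// lee_fin.
apply: nearW => N.
rewrite -ge0_sume_distrl; last by move=> n _; rewrite lee_fin.
by rewrite lee_wpmul2r// sumEFin lee_fin; case: aC.
Qed.

(** Termwise integration turns M^n f into M^(n+1) f, so each coefficient moves up by one index. *)
Lemma avg_avgs x : avg m (avgs a) x = avgs (delay a) x.
Proof.
rewrite /avg integral_nneseries//; last first.
  by move=> n; apply: measurable_funeM; case: (nF n).
rewrite /avgs [in RHS]nneseries_recl//; last first.
  by move=> n _; apply: mule_ge0; [rewrite lee_fin; case: n|exact: F0].
rewrite /= mul0e add0e -[in RHS]nneseries_addn; last first.
  by move=> n; apply: mule_ge0; [rewrite lee_fin; case: n|exact: F0].
apply: eq_eseriesr => n _; rewrite addn1 /= ge0_integralZl ?lee_fin//.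
by case: (nF n).
Qed.

Lemma integrable_fine_avgs x : (m x).-integrable setT (EFin \o (fun y => fine (avgs a y))).
Proof.
apply: measurable_bounded_integrable => //.
- by rewrite (le_lt_trans (sprob_kernel_le1 m x))// ltry.
- exact: measurable_fine_avgs.
- exists C; split; first by rewrite num_real.
  move=> M CM y _ /=; rewrite ger0_norm ?fine_avgs_ge0//.
  by rewrite (le_trans (fine_avgs_le y))// ltW.
Qed.

End fixed.

(** As Delta_m = M - 1, the Laplacian acts on coefficients as [delay a - a], which for [pois t] is
    the time derivative. *)
Lemma lapl_avgs a C x : psum a C ->
  lapl m (fun y => fine (avgs a y)) x = fine (avgs (delay a) x) - fine (avgs a x).
Proof.
move=> aC; rewrite /lapl RintegralB//; last 2 first.
- exact: (integrable_fine_avgs aC).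
- apply: measurable_bounded_integrable => //.
    by rewrite (le_lt_trans (sprob_kernel_le1 m x))// ltry.
  exact: bounded_cst.
rewrite Rintegral_cst// -(avg_avgs aC) /Rintegral.
by rewrite prob_kernel mulr1; congr (fine _ - _); apply: eq_integral => y _;
  rewrite (avgsK aC).
Qed.

End avg_series.
Arguments avgs_cvg {R d X} m {f} nf f1 {a C} aC x.

(** * The heat flow as a Poisson sum *)

Section poisson_flow.
Context {R : realType} {d : measure_display} {X : measurableType d}.
Variables (m : R.-pker X ~> X) (nu : {measure set X -> \bar R}).
Hypothesis rev : reversible_measure m nu.
Variable g : X -> R.
Hypotheses (mg : measurable_fun [set: X] g) (g01 : forall x, 0 <= g x <= 1).
Hypothesis intg : (\int[nu]_x (g x)%:E < +oo)%E.

Local Notation f := (EFin \o g).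

(* e^{t Delta_m} g = e^{-t} sum_n t^n/n! M^n g, with M = avg m *)
Definition pflow (t : R) (x : X) : R := fine (avgs m f (pois t) x).

Let nf : nnmeas f.
Proof. by split; [exact/measurable_EFinP|move=> x; rewrite lee_fin; case/andP: (g01 x)]. Qed.

Let f1 x : (f x <= 1)%E.
Proof. by rewrite lee_fin; case/andP: (g01 x). Qed.

Let q T n := 4 * exp_coeff (4 * T) n : R.

Let psum_q T : 0 <= T -> psum (q T) (4 * expR (4 * T)).
Proof. by move=> T0; apply/psumZ/psum_exp_coeff => //; rewrite mulr_ge0. Qed.

(** The Taylor estimate of each Poisson weight, divided by [h] and summed. The dominating function
    depends only on [T], so its L^2 bound yields differentiability in L^2. *)
Lemma pflow_error (T t h : R) x : 1 <= T -> 0 <= t <= T -> 0 <= t + h <= T -> h != 0 ->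
  `|(pflow (t + h) x - pflow t x) / h - lapl m (pflow t) x| <=
    `|h| * fine (avgs m f (q T) x).
Proof.
move=> T1 tT thT h0.
have pt : psum (pois t) (expR t) by apply: psum_pois; lra.
have pth : psum (pois (t + h)) (expR (t + h)) by apply: psum_pois; lra.
have pq : psum (q T) (4 * expR (4 * T)) by apply: psum_q; lra.
rewrite (lapl_avgs m nf f1 x pt).
have cA := avgs_cvg m nf f1 pth x.
have cB := avgs_cvg m nf f1 pt x.
have cD := avgs_cvg m nf f1 (psum_delay pt) x.
have cQ := avgs_cvg m nf f1 pq x.
(* The inequality is proved for partial sums and passes to the limit. *)
have cE := cvg_norm (cvgB (cvgM (cvgB cA cB) (cvg_cst h^-1)) (cvgB cD cB)).
have cR := cvgM (cvg_cst `|h|) cQ.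
rewrite /pflow; apply: (ler_cvg_to (cE _ _ _ _ _ _) (cR _ _)); apply: nearW => N /=.
rewrite !fctE /=.
rewrite -!sumrB mulr_suml -sumrB mulr_sumr.
apply: le_trans (ler_norm_sum _ _ _) _; apply: ler_sum => n _.
set F := fine _.
have F0 : 0 <= F by rewrite fine_ge0//; case: (nnmeas_iter_avg m n nf).
have -> : (pois (t + h) n * F - pois t n * F) / h - (delay (pois t) n * F - pois t n * F)
  = (pois (t + h) n - pois t n - h * (delay (pois t) n - pois t n)) / h * F by field.
rewrite normrM (ger0_norm F0) mulrA ler_wpM2r// normrM normfV ler_pdivrMr ?normr_gt0//.
apply: le_trans (pois_taylor n T1 tT thT) _.
rewrite -[h ^+ 2]real_normK ?num_real// /q [leRHS](_ : _ = 4 * exp_coeff (4 * T) n * `|h| ^+ 2)//.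
by ring.
Qed.

Let I : R := fine (\int[nu]_x f x).
Let IE : (\int[nu]_x f x = I%:E)%E.
Proof.
rewrite /I fineK// ge0_fin_numE//; apply: integral_ge0 => x _; by case: nf.
Qed.
Let I0 : 0 <= I.
Proof. by rewrite -lee_fin -IE; apply: integral_ge0 => x _; case: nf. Qed.

(** The series lies between 0 and [C], so its square is at most [C] times it, and its integral is at
    most [C * I]. *)
Lemma integral_sqr_avgs a C : psum a C ->
  (\int[nu]_x ((fine (avgs m f a x)) ^+ 2)%:E <= (C ^+ 2 * I)%:E)%E.
Proof.
move=> aC; have C0 := psum_bound_ge0 aC.
have na := nnmeas_avgs m nf aC.
apply: (@le_trans _ _ (\int[nu]_x (C%:E * avgs m f a x))%E).
  apply: ge0_le_integral => //.
  - by move=> x _; rewrite lee_fin sqr_ge0.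
  - by apply/measurable_EFinP/measurable_funX; exact: (measurable_fine_avgs m nf aC).
  - by apply: measurable_funeM; case: na.
  move=> x _; rewrite -(avgsK m nf f1 aC) -EFinM lee_fin expr2 ler_wpM2r//.
    exact: (fine_avgs_ge0 m nf aC).
  exact: (fine_avgs_le m nf f1 aC).
rewrite ge0_integralZl ?lee_fin//; [|by case: na..].
rewrite expr2 -mulrA EFinM lee_wpmul2l ?lee_fin// EFinM -IE.
exact: integral_avgs.
Qed.

Lemma pflow_L2 t : 0 <= t -> L2 nu (pflow t).
Proof.
move=> t0; have pt := psum_pois t0.
have mp : measurable_fun [set: X] (pflow t) by exact: (measurable_fine_avgs m nf pt).
split => //; apply/integrableP; split.
  exact/measurable_EFinP/measurable_funX.
apply: le_lt_trans (ltry (expR t ^+ 2 * I)).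
apply: le_trans (integral_sqr_avgs pt).
rewrite le_eqVlt; apply/orP; left; apply/eqP.
by apply: eq_integral => x _ /=; rewrite ger0_norm// sqr_ge0.
Qed.

Lemma pflow0 x : pflow 0 x = g x.
Proof.
have p0 : psum (pois 0) (expR 0 : R) by exact: psum_pois.
rewrite /pflow -(cvg_lim _ (avgs_cvg m nf f1 p0 x))//; apply: cvg_lim => //.
(* At time 0 only the term of index 0 survives; the shift discards the empty partial sum, after
   which the sequence is constant. *)
rewrite -cvg_shiftS.
apply: cvg_near_cst; apply: nearW => N /=.
rewrite big_nat_recl//= big1 ?addr0.
  by rewrite /pois /exp_coeff /= expr0 fact0 oppr0 expR0 divr1 !mul1r.
by move=> n _; rewrite /pois /exp_coeff /= expr0n /= mul0r mulr0 mul0r.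
Qed.

Lemma pflow_heat_flow : is_heat_flow m nu g pflow.
Proof.
split; [exact: pflow_L2|exact/aeW/pflow0|].
move=> t t0 e e0.
pose T := t + 1; pose C : R := 4 * expR (4 * T).
have C0 : 0 <= C by rewrite mulr_ge0// expR_ge0.
have CI : 0 < C ^+ 2 * I + 1 by rewrite ltr_wpDl// mulr_ge0// sqr_ge0.
(* With |h| <= 1 all times stay in [0, T] and h^2 <= |h|, so the error is at most |h| C^2 I; the
   added 1 avoids dividing by zero. *)
exists (Num.min 1 (e / (C ^+ 2 * I + 1))).
  by rewrite lt_min ltr01 divr_gt0.
move=> h h0; rewrite lt_min => /andP[h1 he] th0.
have hle : `|h| <= 1 by exact: ltW.
have T0 : 0 <= T by rewrite /T; lra.
have tT : 0 <= t <= T by rewrite /T; lra.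
have thT : 0 <= t + h <= T by move: hle; rewrite ler_norml /T; lra.
have T1 : 1 <= T by rewrite /T; lra.
have pq := psum_q T0.
have pt : psum (pois t) (expR t) by exact: psum_pois.
have pth : psum (pois (t + h)) (expR (t + h)) by exact: psum_pois.
have mQ := measurable_fine_avgs m nf pq.
apply: (@le_trans _ _ (\int[nu]_x ((h ^+ 2)%:E * ((fine (avgs m f (q T) x)) ^+ 2)%:E))%E).
  apply: ge0_le_integral => //.
  - by move=> x _; rewrite lee_fin sqr_ge0.
  - apply/measurable_EFinP/measurable_funX/measurable_funB.
      apply: measurable_funM => //; apply: measurable_funB.
        exact: (measurable_fine_avgs m nf pth).
      exact: (measurable_fine_avgs m nf pt).
    rewrite (_ : lapl m (pflow t) = fun x =>
        fine (avgs m f (delay (pois t)) x) - fine (avgs m f (pois t) x)); last first.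
      by apply/funext => x; rewrite -(lapl_avgs m nf f1 x pt).
    apply: measurable_funB; last exact: (measurable_fine_avgs m nf pt).
    exact: (measurable_fine_avgs m nf (psum_delay pt)).
  - by apply: measurable_funeM; exact/measurable_EFinP/measurable_funX.
  - move=> x _; rewrite -EFinM lee_fin -exprMn -[leLHS]real_normK ?num_real//.
    rewrite -[leRHS]real_normK ?num_real// lerXn2r ?nnegrE//.
    apply: le_trans (pflow_error x T1 tT thT h0) _.
    by rewrite normrM (ger0_norm (fine_avgs_ge0 m nf pq x)).
rewrite ge0_integralZl ?lee_fin ?sqr_ge0//; last 2 first.
- exact/measurable_EFinP/measurable_funX.
- by move=> x _; rewrite lee_fin sqr_ge0.
apply: (@le_trans _ _ ((h ^+ 2)%:E * (C ^+ 2 * I)%:E)%E).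
  by rewrite lee_wpmul2l ?lee_fin ?sqr_ge0//; exact: integral_sqr_avgs.
rewrite -EFinM lee_fin.
apply: (@le_trans _ _ (`|h| * (C ^+ 2 * I + 1))).
  apply: ler_pM => //; [exact: sqr_ge0|by rewrite mulr_ge0// sqr_ge0| |].
    by rewrite -[h ^+ 2]real_normK ?num_real// expr2 ler_piMl.
  by rewrite lerDl.
by rewrite -ler_pdivlMr// ltW.
Qed.

End poisson_flow.

(** * Points from which a set cannot be reached *)

Section unreachable_set.
Context {R : realType} {d : measure_display} {X : measurableType d}.
Variables (m : R.-pker X ~> X) (nu : {measure set X -> \bar R}).
Hypothesis rev : reversible_measure m nu.

Lemma measurable_NmD D : measurable D -> measurable (NmD m D).
Proof.
move=> mD; rewrite (_ : NmD m D = \bigcap_n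
    (iter n.+1 (avg m) (EFin \o \1_D) @^-1` [set 0%E])).
  apply: bigcapT_measurable => n; rewrite -[X in measurable X]setTI.
  by case: (nnmeas_iter_avg m n.+1 (nnmeas_indic mD)) => + _; apply.
by apply/seteqP; split=> [x Nx n _|x Nx n]; [rewrite /preimage /mkset -mstarE; [exact: Nx|]|
  rewrite mstarE//; exact: Nx].
Qed.

(* With A = D `&` NmD m D, reversibility turns the square of the L^2 norm of
   the function m_x(A) into the integral over A of m_x^{*2}(A), which vanishes. *)
Lemma measure_setI_NmD D : measurable D -> nu (D `&` NmD m D) = 0%E.
Proof.
move=> mD; set A := D `&` _.
have mA : measurable A by apply: measurableI => //; exact: measurable_NmD.
have nA := nnmeas_indic (R := R) mA; have nD := nnmeas_indic (R := R) mD.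
have n1 := nnmeas_avg m nA.
have ind1 x : ((EFin \o \1_A) x <= 1 :> \bar R)%E.
  by rewrite lee_fin indicE; case: (_ \in _).
have sq0 : (\int[nu]_x (avg m (EFin \o \1_A) x * avg m (EFin \o \1_A) x) = 0)%E.
  rewrite (avg_adjoint rev nA n1); last exact: (@iter_avg_le1 _ _ _ m 1).
  apply: integral0_eq => x _ /=; rewrite indicE.
  case: (boolP (x \in A)) => [|_]; last by rewrite mul0e.
  (* Index 1 stands for [m^{*2}], which does not charge D from a point of A, hence does not charge
     A, a subset of D. *)
  rewrite inE => -[_ /(_ 1%N)]; rewrite mstarE// => N0.
  rewrite mul1e; apply/eqP; rewrite eq_le; apply/andP; split; last first.
    by case: (nnmeas_avg m n1) => _; apply.
  rewrite -N0; apply: (@le_iter_avg _ _ _ m 2) => // y /=.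
  rewrite lee_fin !indicE; have [|_] := boolP (y \in A); last by rewrite ler0n.
  by rewrite inE => -[Dy _]; rewrite mem_set.
have ae0 : ae_eq nu setT (avg m (EFin \o \1_A)) (cst 0%E).
  have [+ _] := @ae_eq_integral_abs _ _ _ nu setT measurableT
    (fun x => avg m (EFin \o \1_A) x * avg m (EFin \o \1_A) x)%E
    (proj1 (nnmeasM n1 n1)).
  case=> [|N [mN N0 sN]].
    by rewrite -[RHS]sq0; apply: eq_integral => x _; rewrite gee0_abs//;
      case: (nnmeasM n1 n1).
  exists N; split => // x /= nx; apply: sN => /= e; apply: nx => Tx.
  by apply/eqP; move/eqP: (e Tx); rewrite mule_eq0 orbb.
(* The integral of m_x(A) is nu(A), and m_x(A) is now known to vanish almost everywhere. *)
have := integral_iter_avg rev 1 nA.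
rewrite /= (ge0_ae_eq_integral _ _ _ _ _ ae0)//; last 2 first.
- by case: n1.
- by move=> x _; case: n1.
by rewrite integral0 integral_indic// setIT.
Qed.

(** The class [P] and the function [g] are left abstract so that indicators and continuous cutoffs
    share one argument. *)
Lemma heat_positivity_NmD (P : (X -> R) -> Prop) D (g : X -> R) :
  heat_positivity m nu P -> measurable D -> (0 < nu D)%E -> (nu D < +oo)%E ->
  measurable_fun [set: X] g -> (forall x, 0 <= g x <= \1_D x) ->
  (forall x, D x -> 0 < g x) -> P g -> nu (NmD m D) = 0%E.
Proof.
move=> hp mD D0 Dfin mg g01 gD Pg.
have nD := nnmeas_indic (R := R) mD.
have g1 x : 0 <= g x <= 1.
  by have := g01 x; rewrite indicE; case: (_ \in _) => /=; lra.
have ng : nnmeas (EFin \o g).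
  by split; [exact/measurable_EFinP|move=> x; rewrite lee_fin; case/andP: (g1 x)].
have gle : (\int[nu]_x (g x)%:E <= nu D)%E.
  rewrite (_ : nu D = \int[nu]_x (\1_D x)%:E)%E; last by rewrite integral_indic// setIT.
  apply: ge0_le_integral => //.
  - by move=> x _; rewrite lee_fin; case/andP: (g1 x).
  - by case: ng.
  - by case: nD.
  - by move=> x _; rewrite lee_fin; case/andP: (g01 x).
have intg : (\int[nu]_x (g x)%:E < +oo)%E by apply: le_lt_trans Dfin.
have L2g : L2 nu g.
  split => //; apply/integrableP; split.
    exact/measurable_EFinP/measurable_funX.
  apply: le_lt_trans intg; apply: ge0_le_integral => //.
  - by apply/measurableT_comp/measurable_EFinP/measurable_funX.
  - by case: ng.
  - move=> x _ /=; rewrite lee_fin ger0_norm ?sqr_ge0// expr2.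
    by case/andP: (g1 x) => g0 g1'; rewrite ler_piMl.
have gn0 : ~ {ae nu, forall x, g x = 0}.
  move=> [N [mN N0 sN]]; move: D0; rewrite lt_neqAle => /andP[+ _].
  rewrite eq_sym => /eqP; apply; apply: (subset_measure0 mD mN) => //.
  move=> x Dx; apply: sN => /= gx; have := gD x Dx.
  by rewrite gx ltxx.
have gae : {ae nu, forall x, 0 <= g x}.
  by apply: aeW => x; case/andP: (g1 x).
have [N [mN N0 sN]] := hp g L2g Pg gae gn0 _
  (pflow_heat_flow rev mg g1 intg) 1 ltr01.
have mND := measurable_NmD mD.
apply: (subset_measure0 mND (B := (D `&` NmD m D) `|` N)).
- by apply: measurableU => //; exact: measurableI.
(* For an unreachable point outside D every M^n g vanishes, the case n = 0 because [g] is 0 off D.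
   The flow is then 0 there, which happens only on the null set [N]. *)
- move=> x Nx; have [Dx|nDx] := pselect (D x); first by left.
  right; apply: sN => /=; apply/negP; rewrite -leNgt.
  have F0 n : iter n (avg m) (EFin \o g) x = 0%E.
    apply/eqP; rewrite eq_le; apply/andP; split; last first.
      by case: (nnmeas_iter_avg m n ng) => _; apply.
    apply: (@le_trans _ _ (iter n (avg m) (EFin \o \1_D) x)).
      by apply: le_iter_avg => // y; rewrite lee_fin; case/andP: (g01 y).
    case: n => [|n]; last by rewrite -mstarE//; rewrite Nx.
    by rewrite /= indicE memNset.
  rewrite /pflow /avgs eseries0 ?fine0// => n _ _.
  by rewrite F0 mule0.
- have mDN : measurable (D `&` NmD m D) by exact: measurableI.
  exact: (etrans (measureU0 mDN mN N0) (measure_setI_NmD mD)).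
Qed.

End unreachable_set.

(** * Open sets and continuous cutoffs *)

Section cutoff.
Context {R : realType} {d : measure_display} {X : measurableType d}.
Variable dist : X -> X -> R.

Lemma dopen_measurable (D : set X) : borel_of dist -> dopen dist D -> measurable D.
Proof. by move=> bo oD; rewrite bo; exact: sub_sigma_algebra. Qed.

Lemma dopen_dcontinuous_gt (g : X -> R) r : dcontinuous dist g ->
  dopen dist [set x | r < g x].
Proof.
move=> cg x /= rg; have [|del del0 H] := cg x (g x - r); first by rewrite subr_gt0.
by exists del => // y /H; rewrite ltr_norml => /andP[+ _] /=; lra.
Qed.

Lemma dcontinuous_measurable (g : X -> R) : borel_of dist -> dcontinuous dist g ->
  measurable_fun [set: X] g.
Proof.
move=> bo cg mT; apply: (measurability _ (RGenOInfty.measurableE R)) => //.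
move=> _ [_ [r ->] <-].
rewrite setTI; apply: (dopen_measurable bo).
rewrite (_ : _ @^-1` _ = [set x | r < g x]); first exact: dopen_dcontinuous_gt.
by apply/seteqP; split => x /=; rewrite in_itv/= andbT.
Qed.

Hypothesis metric : is_metric dist.

(** The cutoff is the distance to the complement of D truncated at 1, written as a supremum of radii
    of balls inside D so that D may be the whole space. *)
Lemma dopen_cutoff (D : set X) : dopen dist D -> exists g : X -> R,
  [/\ dcontinuous dist g, forall x, 0 <= g x <= \1_D x &
      forall x, D x -> 0 < g x].
Proof.
move=> oD; have [d0 dE dC dT] := metric.
pose S x : set R := [set e | 0 <= e <= 1 /\ dball dist x e `<=` D].
(* The ball of radius 0 is empty, so the supremum is over a nonempty set even outside D. *)
have S0 x : S x 0.
  by split; [rewrite lexx ler01|move=> y; rewrite /dball/= ltNge d0].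
have hS x : has_sup (S x).
  by split; [exists 0|exists 1 => e [/andP[]]].
have Sle x e : S x e -> e <= sup (S x) by move=> Se; apply: ub_le_sup => //; case: (hS x).
exists (fun x => sup (S x)).
(* A ball of radius e about x contains the ball of radius e - d(x,y) about y, so the cutoff is
   1-Lipschitz. *)
have lip x y : sup (S x) - dist x y <= sup (S y).
  rewrite lerBlDr; apply: ge_sup; first by exists 0.
  move=> e [/andP[e0 e1] eD]; rewrite -lerBlDr.
  have [le|lt] := leP (dist x y) e; last first.
    by apply: le_trans (Sle y 0 (S0 y)); rewrite subr_le0 ltW.
  apply: Sle; split; first by have := d0 x y; lra.
  move=> z; rewrite /dball/= => yz; apply: eD.
  by rewrite /dball/=; apply: le_lt_trans (dT x y z) _; lra.
split.
- move=> x e e0; exists e => // y xy.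
  have := lip x y; have := lip y x; rewrite (dC y x) ltr_norml; lra.
- move=> x; rewrite (Sle _ _ (S0 x))/= indicE.
  case: (boolP (x \in D)) => [_|nD]; apply: ge_sup; try by exists 0.
    by move=> e [/andP[]].
  move=> e [_ eD]; rewrite leNgt; apply/negP => e0.
  by move/negP: nD; apply; rewrite inE; apply: eD; rewrite /dball/= (dE x x).2.
- move=> x /oD[e e0 eD]; apply: (@lt_le_trans _ _ (Num.min e 1)).
    by rewrite lt_min e0 ltr01.
  apply: Sle; split; first by rewrite le_min ltW//= ler01 ge_min lexx orbT.
  by move=> y yx; apply: eD; apply: lt_le_trans yx _; rewrite ge_min lexx.
Qed.

End cutoff.

(** * A cascade of differential equations *)

Section positivity_cascade.
Context {R : realType}.

Definition derive_on_ge0 (f l : R -> R) := forall t : R, 0 <= t -> forall e : R, 0 < e ->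
  exists2 del, 0 < del & forall h, h != 0 -> `|h| < del -> 0 <= t + h ->
    `|(f (t + h) - f t) / h - l t| <= e.

(* Prolonging f affinely to the left of 0 makes the derivative at 0 two-sided. *)
Lemma derive_on_ge0_extend (f l : R -> R) : derive_on_ge0 f l ->
  exists2 g : R -> R, (forall t : R, 0 <= t -> g t = f t) &
    forall t : R, 0 <= t -> is_derive t 1 g (l t).
Proof.
move=> fl; exists (fun t => if 0 <= t then f t else f 0 + t * l 0) => [t ->//|t t0].
set g := fun t => _.
suff gl : h^-1 *: (g (h *: 1 + t) - g t) @[h --> 0^'] --> l t.
  by apply: DeriveDef; [apply: cvgP gl|exact: cvg_lim gl].
apply/cvgrPdist_le => e e0.
have [del del0 H] := fl t t0 e e0.
have step h : h != 0 -> `|h| < del -> 0 <= t + h ->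
    `|l t - h^-1 *: (g (h *: 1 + t) - g t)| <= e.
  move=> h0 hd th; rewrite distrC /g /GRing.scale/= mulr1 addrC (addrC h) th t0.
  by rewrite mulrC addrC; exact: H.
have [t_eq0|tp] := eqVneq t 0.
  near=> h; have h0 : h != 0 by near: h; exact: nbhs_dnbhs_neq.
  have [hp|hn] := leP 0 h.
    apply: step => //; last by rewrite t_eq0 add0r.
    near: h; apply: dnbhs0_lt => //.
  rewrite t_eq0 /g /GRing.scale/= mulr1 addr0 lexx [0 <= h]leNgt hn/=.
  by rewrite addrAC subrr add0r mulrA mulVf// mul1r subrr normr0 ltW.
have {}tp : 0 < t by rewrite lt_neqAle eq_sym tp.
near=> h; apply: step.
- by near: h; exact: nbhs_dnbhs_neq.
- by near: h; apply: dnbhs0_lt.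
- have : `|h| < t by near: h; apply: dnbhs0_lt.
  by rewrite ltr_norml; lra.
Unshelve. all: by end_near. Qed.

(** The derivative of e^t a(t) is e^t b(t); integrating its lower bound from 0 raises t^k/k! to the
    next coefficient. *)
Lemma growth_step (a b : R -> R) (T c : R) k :
  derive_on_ge0 a (fun t => b t - a t) ->
  (forall t, 0 <= t <= T -> c * exp_coeff t k <= expR t * b t) ->
  forall t, 0 <= t <= T -> a 0 + c * exp_coeff t k.+1 <= expR t * a t.
Proof.
move=> /derive_on_ge0_extend[g ga gd] bc t /andP[t0 tT].
(* nondecreasing: F' = expR * b - c * exp_coeff _ k *)
pose F s := expR s * g s - c * exp_coeff s k.+1.
have Fd (s : R) : 0 <= s -> is_derive s 1 F (expR s * b s - c * exp_coeff s k).
  move=> s0; have := gd s s0; have := is_derive_exp_coeff k.+1 s => ? ?.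
  rewrite /F; apply: is_derive_eq.
  by rewrite /GRing.scale/= ga//; ring.
have [||s] := @MVT_segment R F (fun s => expR s * b s - c * exp_coeff s k) 0 t t0.
- by move=> s; rewrite in_itv/= => /andP[/ltW s0 _]; exact: Fd.
- apply: derivable_within_continuous => s; rewrite in_itv/= => /andP[s0 _].
  by have := Fd s s0 => ?; apply: ex_derive.
rewrite in_itv/= subr0 => /andP[s0 st].
have E0 : exp_coeff (0 : R) k.+1 = 0 by rewrite /exp_coeff/= expr0n mul0r.
rewrite /F E0 expR0 !ga// mul1r mulr0 subr0 => FE.
have bs : 0 <= expR s * b s - c * exp_coeff s k.
  by rewrite subr_ge0 bc// s0 (le_trans st).
have : 0 <= (expR s * b s - c * exp_coeff s k) * t by rewrite mulr_ge0.
by rewrite -FE; lra.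
Qed.

(* The functions e^t * phi n t are the successive derivatives of the first one
   and are bounded uniformly in n, so Taylor remainders tend to 0. *)
Variables (phi : nat -> R -> R) (T K : R).
Hypothesis T0 : 0 < T.
Hypothesis phiD : forall n, derive_on_ge0 (phi n) (fun t => phi n.+1 t - phi n t).
Hypothesis phiK : forall n t, 0 <= t <= T -> `|phi n t| <= K.
Hypothesis phi0 : forall n, 0 <= phi n 0.

(** The uniform bound [- (expR T * K)], integrated N times while the nonnegative initial values are
    dropped, gains the factor t^N/N!, which tends to 0. *)
Lemma cascade_ge0 n t : 0 <= t <= T -> 0 <= expR t * phi n t.
Proof.
have K0 : 0 <= K.
  have /(phiK 0%N) : 0 <= (0 : R) <= T by rewrite lexx ltW.
  exact: le_trans.
have low N : forall n t, 0 <= t <= T ->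
    - (expR T * K) * exp_coeff t N <= expR t * phi n t.
  elim: N => [{}n {}t tT|N ih {}n {}t tT].
    rewrite /exp_coeff/= expr0 fact0 divr1 mulr1 lerNl -mulrN.
    apply: (@le_trans _ _ (expR t * K)).
      rewrite ler_wpM2l ?expR_ge0//.
      by have := phiK n tT; rewrite ler_norml; lra.
    by rewrite ler_wpM2r// ler_expR; case/andP: tT.
  have := growth_step (phiD n) (ih n.+1) tT.
  by apply: le_trans; rewrite lerDr.
move=> tT.
have c : - (expR T * K) * exp_coeff t N @[N --> \oo] --> - (expR T * K) * 0.
  by apply: cvgM; [exact: cvg_cst|exact: cvg_exp_coeff].
rewrite -[leLHS](mulr0 (- (expR T * K))) -(cvg_lim _ c)//.
apply: limr_le; first by apply: cvgP c.
by apply: nearW => N; exact: low.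
Qed.

(** Going down from index j + p, each integration drops a nonnegative initial value and keeps the
    contribution of the top one. *)
Lemma cascade_lower j p t : 0 <= t <= T ->
  phi (j + p) 0 * exp_coeff t j <= expR t * phi p t.
Proof.
elim: j p t => [|j ih] p t tT.
  have H s : 0 <= s <= T -> 0 * exp_coeff s 0 <= expR s * phi p.+1 s.
    by move=> sT; rewrite mul0r cascade_ge0.
  have := growth_step (phiD p) H tT.
  by rewrite mul0r addr0 add0n /exp_coeff/= expr0 fact0 divr1 mulr1.
rewrite addSnnS; apply: le_trans (growth_step (phiD p) (ih p.+1) tT).
by rewrite lerDr.
Qed.

Lemma cascade_eq0 : phi 0 T <= 0 -> forall n, phi n 0 = 0.
Proof.
move=> phiT n; apply/eqP; rewrite eq_le phi0 andbT.
have TT : 0 <= T <= T by rewrite lexx ltW.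
have : phi n 0 * exp_coeff T n <= 0.
  have := cascade_lower n 0 TT; rewrite addn0 => /le_trans; apply.
  by rewrite pmulr_rle0// expR_gt0.
by rewrite pmulr_lle0// /exp_coeff/= divr_gt0 ?exprn_gt0// ltr0n fact_gt0.
Qed.

End positivity_cascade.

(** * The Laplacian on square integrable functions *)

Section square_integrable.
Context {R : realType} {d : measure_display} {X : measurableType d}.
Variable nu : {measure set X -> \bar R}.
Implicit Types f g w : X -> R.

Lemma integrable_domin f g : measurable_fun [set: X] f ->
  (forall x, `|f x| <= g x) -> nu.-integrable setT (EFin \o g) ->
  nu.-integrable setT (EFin \o f).
Proof.
move=> mf fg; apply: le_integrable => //; first exact/measurable_EFinP.
by move=> x _ /=; rewrite lee_fin (le_trans (fg x))// ler_norm.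
Qed.

Lemma L2_domin f g : measurable_fun [set: X] f -> (forall x, `|f x| <= g x) ->
  L2 nu g -> L2 nu f.
Proof.
move=> mf fg [mg ig]; split => //.
apply: integrable_domin ig; first exact: measurable_funX.
move=> x; rewrite normrX lerXn2r// nnegrE// (le_trans _ (fg x))//.
Qed.

Lemma L2D f g : L2 nu f -> L2 nu g -> L2 nu (f \+ g).
Proof.
move=> [mf if2] [mg ig2]; split; first exact: measurable_funD.
apply: (@integrable_domin _ (fun x => 2 * f x ^+ 2 + 2 * g x ^+ 2)).
- exact/measurable_funX/measurable_funD.
- move=> x /=; rewrite ger0_norm ?sqr_ge0//.
  by have := sqr_ge0 (f x - g x); rewrite !expr2; nra.
- by have := integrableD measurableT (integrableZl measurableT 2 if2)
    (integrableZl measurableT 2 ig2).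
Qed.

Lemma L2Z c f : L2 nu f -> L2 nu (fun x => c * f x).
Proof.
move=> [mf if2]; split; first exact: measurable_funM.
rewrite (_ : (fun x => _) = fun x => (c ^+ 2)%:E * (f x ^+ 2)%:E)%E; last first.
  by apply/funext => x; rewrite exprMn EFinM.
exact: integrableZl.
Qed.

(** This class is stable under M with the same [b] ([test_ravg]), the source of all bounds uniform
    in n. *)
Definition test_fun (b : R) w := [/\ measurable_fun [set: X] w,
  forall x, 0 <= w x <= 1 & (\int[nu]_x (w x)%:E <= b%:E)%E].

Section test.
Variables (b : R) (w : X -> R).
Hypothesis tw : test_fun b w.

Lemma test_nnmeas : nnmeas (EFin \o w).
Proof.
case: tw => mw w01 _; split; first exact/measurable_EFinP.
by move=> x; rewrite lee_fin; case/andP: (w01 x).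
Qed.

Lemma test_integrable : nu.-integrable setT (EFin \o w).
Proof.
case: tw => mw w01 wb; apply/integrableP; split; first exact/measurable_EFinP.
apply: le_lt_trans (ltry b); apply: le_trans wb; rewrite le_eqVlt; apply/orP; left.
apply/eqP; apply: eq_integral => x _ /=.
by rewrite ger0_norm//; case/andP: (w01 x).
Qed.

Lemma test_bound_ge0 : 0 <= b.
Proof.
case: tw => _ w01 wb; rewrite -lee_fin; apply: le_trans wb.
by apply: integral_ge0 => x _; rewrite lee_fin; case/andP: (w01 x).
Qed.

(** Young's inequality with weight [lam], where w^2 <= w since 0 <= w <= 1. *)
Lemma test_pointwise (lam x : R) (y : X) : 0 < lam ->
  `|x * w y| <= lam * x ^+ 2 + lam^-1 * w y.
Proof.
case: tw => _ w01 _ l0; have /andP[w0 w1] := w01 y.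
rewrite normrM (ger0_norm w0) -[x ^+ 2]real_normK ?num_real//.
set a := `|x|; set v := w y; have a0 : 0 <= a by exact: normr_ge0.
suff : 0 <= lam * (lam * a ^+ 2 + lam^-1 * v - a * v).
  by rewrite pmulr_rge0// subr_ge0.
have -> : lam * (lam * a ^+ 2 + lam^-1 * v - a * v) =
    lam * lam * (a * a) + v - lam * a * v by field; rewrite gt_eqF.
have := sqr_ge0 (lam * a - v); rewrite !expr2.
have : 0 <= lam * a * v by apply: mulr_ge0 => //; apply: mulr_ge0 => //; exact: ltW.
have : v * v <= v by rewrite ler_piMl.
by nra.
Qed.

Lemma L2_test_integrable f : L2 nu f -> nu.-integrable setT (EFin \o (fun x => f x * w x)).
Proof.
move=> [mf if2]; case: (tw) => mw _ _.
apply: (@integrable_domin _ (fun x => 1 * f x ^+ 2 + 1^-1 * w x)).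
- exact: measurable_funM.
- by move=> x; exact: test_pointwise.
- by have := integrableD measurableT (integrableZl measurableT 1 if2)
    (integrableZl measurableT 1^-1 test_integrable).
Qed.

(** This replaces the Cauchy-Schwarz inequality: a large [lam] makes the [b] term small, then a
    small norm of [f] handles the other. *)
Lemma L2_test_bound f (lam : R) : 0 < lam -> L2 nu f ->
  `|\int[nu]_x (f x * w x)| <= lam * \int[nu]_x (f x ^+ 2) + lam^-1 * b.
Proof.
move=> l0 lf; have [mf if2] := lf; have [mw w01 wb] := tw.
have i2 : nu.-integrable setT (EFin \o (fun x => lam * f x ^+ 2)).
  exact: (integrableZl measurableT lam if2).
have iw : nu.-integrable setT (EFin \o (fun x => lam^-1 * w x)).
  exact: (integrableZl measurableT lam^-1 test_integrable).
have ifw := L2_test_integrable lf.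
apply: le_trans (le_normr_Rintegral _ _) _ => //.
apply: (@le_trans _ _ (\int[nu]_x (lam * f x ^+ 2 + lam^-1 * w x))).
  apply: le_Rintegral => //.
  - exact: (integrable_norm ifw).
  - by have := integrableD measurableT i2 iw.
  - by move=> x _; exact: test_pointwise.
rewrite (RintegralD measurableT i2 iw) (RintegralZl lam measurableT if2).
rewrite (RintegralZl _ measurableT test_integrable).
rewrite lerD2l ler_wpM2l ?invr_ge0 ?(ltW l0)// -lee_fin fineK//.
exact: (integrable_fin_num measurableT test_integrable).
Qed.

End test.

Variable m : R.-pker X ~> X.
Hypothesis rev : reversible_measure m nu.

(** M preserves the integral of f^2, so M(f^2) is finite almost everywhere, and |f| <= 1 + f^2. *)
Lemma L2_ae_integrable f : L2 nu f ->
  {ae nu, forall x, (m x).-integrable setT (EFin \o f)}.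
Proof.
move=> [mf if2].
have ns : nnmeas (fun x => (f x ^+ 2)%:E).
  by split; [exact/measurable_EFinP/measurable_funX|move=> x; rewrite lee_fin sqr_ge0].
have [ma a0] := nnmeas_avg m ns.
have : nu.-integrable setT (avg m (fun x => (f x ^+ 2)%:E)).
  apply/integrableP; split => //.
  rewrite (eq_integral (avg m (fun x => (f x ^+ 2)%:E))); last first.
    by move=> x _; rewrite gee0_abs.
  rewrite (integral_iter_avg rev 1 ns).
  case/integrableP: if2 => _; congr (_ < _)%E; apply: eq_integral => x _ /=.
  by rewrite ger0_norm// sqr_ge0.
move=> /(integrable_ae measurableT); apply: filterS => x /(_ Logic.I) fin.
have i1 : (m x).-integrable setT (EFin \o cst (1 : R)).
  apply: measurable_bounded_integrable => //; last exact: bounded_cst.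
  by rewrite (le_lt_trans (sprob_kernel_le1 m x))// ltry.
have i2 : (m x).-integrable setT (fun y => (f y ^+ 2)%:E).
  apply/integrableP; split; first by case: ns.
  rewrite (eq_integral (fun y => (f y ^+ 2)%:E)); last first.
    by move=> y _ /=; rewrite ger0_norm// sqr_ge0.
  by rewrite ltey_eq fin.
apply: le_integrable (integrableD measurableT i1 i2) => //.
  exact/measurable_EFinP.
move=> y _ /=; rewrite lee_fin [leRHS]ger0_norm ?addr_ge0 ?sqr_ge0//.
rewrite -[f y ^+ 2]real_normK ?num_real//.
by have := sqr_ge0 (`|f y| - 1); rewrite !expr2; have := normr_ge0 (f y); nra.
Qed.

Definition ravg (f : X -> R) (x : X) : R := fine (avg m (EFin \o f) x).

Lemma test_ravg b w : test_fun b w -> test_fun b (ravg w).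
Proof.
move=> tw; have nw := test_nnmeas tw; have [mw w01 wb] := tw.
have [ma a0] := nnmeas_avg m nw.
have w1 x : ((EFin \o w) x <= 1)%E by rewrite lee_fin; case/andP: (w01 x).
have a1 x : (avg m (EFin \o w) x <= 1)%E by exact: (@iter_avg_le1 _ _ _ m 1).
have af x : (ravg w x)%:E = avg m (EFin \o w) x.
  by rewrite fineK// bounded_fin// ; exact: nnmeas_avg.
split; first exact: measurableT_comp.
- by move=> x; rewrite -!lee_fin af a0 a1.
- by under eq_integral do rewrite af; rewrite (integral_iter_avg rev 1 nw).
Qed.

Lemma ravgK b w x : test_fun b w -> (ravg w x)%:E = avg m (EFin \o w) x.
Proof.
move=> tw; have nw := test_nnmeas tw; have [mw w01 wb] := tw.
rewrite fineK//; apply: bounded_fin; first exact: nnmeas_avg.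
by apply: (@iter_avg_le1 _ _ _ m 1) => // y; rewrite lee_fin; case/andP: (w01 y).
Qed.

(** The average of [f] may be infinite on a null set, where [fine] puts 0; elsewhere this is
    [avg_adjoint]. *)
Lemma ravg_adjoint b w f : test_fun b w -> L2 nu f -> (forall x, 0 <= f x) ->
  nu.-integrable setT (EFin \o (fun x => ravg f x * w x)) /\
  \int[nu]_x (ravg f x * w x) = \int[nu]_x (f x * ravg w x).
Proof.
move=> tw lf f0; have nw := test_nnmeas tw; have [mw w01 wb] := tw.
have [mf if2] := lf.
have nf : nnmeas (EFin \o f).
  by split; [exact/measurable_EFinP|move=> x; rewrite lee_fin].
have [ma a0] := nnmeas_avg m nf.
have mrw : measurable_fun [set: X] (fun x => ravg f x * w x).
  by apply: measurable_funM => //; exact: measurableT_comp.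
have E : (\int[nu]_x (ravg f x * w x)%:E = \int[nu]_x (f x * ravg w x)%:E)%E.
  transitivity (\int[nu]_x (avg m (EFin \o f) x * (EFin \o w) x))%E; last first.
    rewrite (avg_adjoint rev nf nw); last by move=> x; rewrite lee_fin; case/andP: (w01 x).
    by apply: eq_integral => x _; rewrite EFinM (ravgK _ tw).
  apply: ge0_ae_eq_integral => //.
  - exact/measurable_EFinP.
  - by case: (nnmeasM (nnmeas_avg m nf) nw).
  - by move=> x _; rewrite lee_fin mulr_ge0 ?fine_ge0//; case/andP: (w01 x).
  - by move=> x _; case: (nnmeasM (nnmeas_avg m nf) nw).
  apply: filterS (L2_ae_integrable lf) => x ix _.
  by rewrite EFinM /ravg fineK//; exact: integrable_fin_num.
split; last by rewrite /Rintegral E.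
apply/integrableP; split; first exact/measurable_EFinP.
rewrite (eq_integral (fun x => (ravg f x * w x)%:E)); last first.
  move=> x _ /=; rewrite ger0_norm// mulr_ge0 ?fine_ge0//; by case/andP: (w01 x).
rewrite E; have := L2_test_integrable (test_ravg tw) lf.
move=> /(integrable_fin_num measurableT); rewrite ltey_eq => -> //.
Qed.

Lemma measurable_lapl f : measurable_fun [set: X] f -> measurable_fun [set: X] (lapl m f).
Proof.
move=> mf; apply: measurableT_comp => //.
under eq_fun do rewrite integralE.
have mk : measurable_fun [set: X * X] (fun p => (f p.2 - f p.1)%:E).
  apply/measurable_EFinP/measurable_funB; apply: measurableT_comp => //.
pose k (p : X * X) : \bar R := (f p.2 - f p.1)%:E.
apply: emeasurable_funB.
- have := measurable_fun_integral_sfinite_kernel (k^\+)%E m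
    (funepos_ge0 k) (measurable_funepos mk).
  congr (measurable_fun _ _); apply/funext => x; apply: eq_integral => y _.
  by rewrite !funeposE.
- have := measurable_fun_integral_sfinite_kernel (k^\-)%E m
    (funeneg_ge0 k) (measurable_funeneg mk).
  congr (measurable_fun _ _); apply/funext => x; apply: eq_integral => y _.
  by rewrite !funenegE.
Qed.

(** Symmetry of M is available for nonnegative functions, so [f] is split into positive and negative
    parts; off a null set both are integrable and lapl f = M p - M n - f. *)
Lemma lapl_test b w f : test_fun b w -> L2 nu f ->
  nu.-integrable setT (EFin \o (fun x => lapl m f x * w x)) /\
  \int[nu]_x (lapl m f x * w x) =
    \int[nu]_x (f x * ravg w x) - \int[nu]_x (f x * w x).
Proof.
move=> tw lf; have [mf if2] := lf; have [mw w01 wb] := tw.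
pose p x := Num.max (f x) 0; pose n x := Num.max (- f x) 0.
have mp : measurable_fun [set: X] p by exact: measurable_maxr.
have mn : measurable_fun [set: X] n.
  by apply: measurable_maxr => //; exact: measurableT_comp.
have p0 x : 0 <= p x by rewrite /p le_max lexx orbT.
have n0 x : 0 <= n x by rewrite /n le_max lexx orbT.
have pnE x : f x = p x - n x.
  by rewrite /p /n; have [|] := leP (f x) 0; have [|] := leP (- f x) 0; lra.
have lef (g : X -> R) : (g = p \/ g = n) -> forall x, `|g x| <= `|f x|.
  move=> gE x; have [f0|f0] := leP 0 (f x); move: gE => [->|->].
  - by rewrite /p max_l.
  - by rewrite /n max_r ?normr0// oppr_le0.
  - by rewrite /p max_r ?normr0// ltW.
  - by rewrite /n max_l ?normrN// oppr_ge0 ltW.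
have lnf : L2 nu (fun x => `|f x|).
  split; first exact: measurableT_comp.
  by under eq_fun do rewrite real_normK ?num_real//.
have lp : L2 nu p by apply: L2_domin lnf => //; apply: lef; left.
have ln : L2 nu n by apply: L2_domin lnf => //; apply: lef; right.
have [ip Ep] := ravg_adjoint tw lp p0.
have [inn En] := ravg_adjoint tw ln n0.
have ifw := L2_test_integrable tw lf.
have tr := test_ravg tw.
pose g x := ravg p x * w x - ravg n x * w x - f x * w x.
have ig : nu.-integrable setT (EFin \o g).
  exact: (integrableB measurableT (integrableB measurableT ip inn) ifw).
have ae : ae_eq nu setT (EFin \o (fun x => lapl m f x * w x)) (EFin \o g).
  apply: filterS3 (L2_ae_integrable lf) (L2_ae_integrable lp) (L2_ae_integrable ln).
  move=> x xf xp xn _ /=; congr EFin; rewrite /g -!mulrBl; congr (_ * _).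
  rewrite /lapl RintegralB//; last first.
    apply: measurable_bounded_integrable => //; last exact: bounded_cst.
    by rewrite (le_lt_trans (sprob_kernel_le1 m x))// ltry.
  rewrite Rintegral_cst// prob_kernel mulr1; congr (_ - _).
  by rewrite -RintegralB//; apply: eq_Rintegral => y _; rewrite pnE.
have ml : measurable_fun [set: X] (fun x => lapl m f x * w x).
  by apply: measurable_funM => //; exact: measurable_lapl.
split.
  apply/integrableP; split; first exact/measurable_EFinP.
  case/integrableP: ig => mg; congr (_ < _)%E; apply: ge0_ae_eq_integral => //.
  - exact: measurableT_comp.
  - by apply: measurableT_comp => //; exact/measurable_EFinP.
  by apply: filterS ae => x /(_ Logic.I) /= e _ /=; case: e => ->.
transitivity (\int[nu]_x g x).
  congr fine; apply: ae_eq_integral => //; first exact/measurable_EFinP.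
  by case/integrableP: ig.
rewrite /g RintegralB//; last exact: (integrableB measurableT ip inn).
rewrite RintegralB// Ep En -RintegralB//; last 2 first.
- exact: (L2_test_integrable tr lp).
- exact: (L2_test_integrable tr ln).
congr (_ - _); apply: eq_Rintegral => x _.
by rewrite [in RHS]pnE mulrBl.
Qed.

End square_integrable.

(** * Testing a heat flow against iterated averages *)

Section heat_flow_tests.
Context {R : realType} {d : measure_display} {X : measurableType d}.
Variables (m : R.-pker X ~> X) (nu : {measure set X -> \bar R}).
Hypothesis rev : reversible_measure m nu.

Definition sqn (f : X -> R) : R := \int[nu]_x (f x ^+ 2).

Lemma sqn_ge0 f : 0 <= sqn f.
Proof. by apply: Rintegral_ge0 => x _; exact: sqr_ge0. Qed.

Lemma sqnZ c f : L2 nu f -> sqn (fun x => c * f x) = c ^+ 2 * sqn f.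
Proof.
move=> [mf if2]; rewrite /sqn -RintegralZl//.
by apply: eq_Rintegral => x _; rewrite exprMn.
Qed.

Lemma sqnD f g : L2 nu f -> L2 nu g -> sqn (f \+ g) <= 2 * sqn f + 2 * sqn g.
Proof.
move=> lf lg; have [mf if2] := lf; have [mg ig2] := lg; have [_ ifg] := L2D lf lg.
have i1 : nu.-integrable setT (EFin \o (fun x => 2 * f x ^+ 2)).
  exact: (integrableZl measurableT 2 if2).
have i2 : nu.-integrable setT (EFin \o (fun x => 2 * g x ^+ 2)).
  exact: (integrableZl measurableT 2 ig2).
rewrite /sqn -(RintegralZl 2 measurableT if2) -(RintegralZl 2 measurableT ig2).
rewrite -(RintegralD measurableT i1 i2); apply: le_Rintegral => //.
  by have := integrableD measurableT i1 i2.
by move=> x _ /=; have := sqr_ge0 (f x - g x); rewrite !expr2; nra.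
Qed.

Variables (u0 : X -> R) (u : R -> X -> R).
Hypothesis hu : is_heat_flow m nu u0 u.

Let uL2 t : 0 <= t -> L2 nu (u t). Proof. by case: hu => + _ _; apply. Qed.

Definition flow_error t h x := (u (t + h) x - u t x) / h - lapl m (u t) x.

Lemma flow_error_small t e : 0 <= t -> 0 < e -> exists2 del : R, 0 < del &
  forall h, h != 0 -> `|h| < del -> 0 <= t + h ->
    L2 nu (flow_error t h) /\ sqn (flow_error t h) <= e.
Proof.
move=> t0 e0; case: hu => _ _ /(_ t t0 e e0)[del del0 H]; exists del => // h h0 hd th.
have {}H := H h h0 hd th.
have mE : measurable_fun [set: X] (flow_error t h).
  apply: measurable_funB; last by apply: measurable_lapl; case: (uL2 t0).
  by apply: measurable_funM => //; apply: measurable_funB;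
    [case: (uL2 th)|case: (uL2 t0)].
have iE : nu.-integrable setT (fun x => ((flow_error t h x) ^+ 2)%:E).
  apply/integrableP; split; first exact/measurable_EFinP/measurable_funX.
  apply: le_lt_trans (ltry e); apply: le_trans H; rewrite le_eqVlt; apply/orP; left.
  by apply/eqP; apply: eq_integral => x _ /=; rewrite ger0_norm ?sqr_ge0.
split; first by split.
by rewrite -lee_fin fineK//; exact: (integrable_fin_num measurableT iE).
Qed.

Lemma flow_locally_bounded t : 0 <= t -> exists2 del : R, 0 < del &
  exists C, forall s, 0 <= s -> `|s - t| < del -> sqn (u s) <= C.
Proof.
move=> t0; have [del del0 H] := flow_error_small t0 ltr01.
pose h0 := del / 2.
have h0p : 0 < h0 by rewrite divr_gt0.
have h0d : h0 < del by rewrite /h0; lra.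
have th0 : 0 <= t + h0 by lra.
have [|||lE0 sE0] := H h0 => //; [by rewrite gt_eqF|by rewrite gtr0_norm|].
(* [sqnD] applied twice to the four summands of [us] below, with (1 - r)^2 <= 4, r^2 <= 1 and both
   errors of squared norm at most 1. *)
exists h0 => //; exists (4 * (4 * sqn (u t) + sqn (u (t + h0)) + 2 * h0 ^+ 2)).
move=> s s0 st.
have N0 := sqn_ge0 (u t); have N1 := sqn_ge0 (u (t + h0)).
have hh := sqr_ge0 h0.
have [->|sneq] := eqVneq s t; first by lra.
pose h := s - t.
have sE : s = t + h by rewrite /h; lra.
have hn0 : h != 0 by rewrite subr_eq0.
have [|||lE sEh] := H h => //; [exact: lt_trans st h0d|by rewrite -sE|].
pose r := h / h0.
have r1 : `|r| <= 1 by rewrite normrM normfV (gtr0_norm h0p) ler_pdivrMr// mul1r ltW.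
(* Comparing the increments h and h0 eliminates the Laplacian, which is thus
   never required to be bounded on L^2. *)
have us : u s = (fun x => (1 - r) * u t x) \+ (fun x => r * u (t + h0) x) \+
    ((fun x => h * flow_error t h x) \+ (fun x => - h * flow_error t h0 x)).
  apply/funext => x /=; rewrite /flow_error -sE /r; field.
  by rewrite hn0 gt_eqF.
have la := L2Z (1 - r) (uL2 t0); have lc := L2Z r (uL2 th0).
have le := L2Z h lE; have le0 := L2Z (- h) lE0.
rewrite us; apply: le_trans (sqnD (L2D la lc) (L2D le le0)) _.
have := sqnD la lc; have := sqnD le le0.
rewrite (sqnZ _ (uL2 t0)) (sqnZ _ (uL2 th0)) (sqnZ _ lE) (sqnZ _ lE0) sqrrN.
have hle : h ^+ 2 <= h0 ^+ 2.
  by rewrite -[h ^+ 2]real_normK ?num_real// lerXn2r ?nnegrE// ltW.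
have r2 : r ^+ 2 <= 1 by rewrite -[r ^+ 2]real_normK ?num_real// exprn_ile1.
have r3 : (1 - r) ^+ 2 <= 4 by move: r1; rewrite ler_norml => /andP[? ?]; rewrite expr2; nra.
have b1 : (1 - r) ^+ 2 * sqn (u t) <= 4 * sqn (u t) by rewrite ler_wpM2r.
have b2 : r ^+ 2 * sqn (u (t + h0)) <= 1 * sqn (u (t + h0)) by rewrite ler_wpM2r.
have b3 : h ^+ 2 * sqn (flow_error t h) <= h0 ^+ 2 * 1.
  by apply: ler_pM => //; [exact: sqr_ge0|exact: sqn_ge0].
have b4 : h ^+ 2 * sqn (flow_error t h0) <= h0 ^+ 2 * 1.
  by apply: ler_pM => //; [exact: sqr_ge0|exact: sqn_ge0].
lra.
Qed.

(** Compactness of [0, T] in its near-covering form, along the filter of bounds tending to infinity,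
    makes the local bounds uniform. *)
Lemma flow_bounded T : exists K, forall t, 0 <= t <= T -> sqn (u t) <= K.
Proof.
have cT := @segment_compact R 0 T.
have [|M [_ HM]] := (iffLR (compact_near_coveringP _)) cT R (pinfty_nbhs R)
    (fun M s => 0 <= s -> sqn (u s) <= M) _.
  move=> t; rewrite /= in_itv/= => /andP[t0 _].
  have [del del0 [C HC]] := flow_locally_bounded t0.
  exists (ball t del, [set M | C < M]) => /=.
    by split; [exact: nbhsx_ballx|exists C; split => //; rewrite num_real].
  move=> [s M] [/= ts CM] s0; apply: le_trans (ltW CM); apply: HC => //.
  by move: ts; rewrite /ball/= distrC.
exists (M + 1) => t tT; have := HM (M + 1) _ t; apply.
- by rewrite ltrDl.
- by rewrite /= in_itv.
- by case/andP: tT.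
Qed.

Variables (b : R) (w : X -> R).
Hypothesis tw : test_fun nu b w.

Definition test_iter n : X -> R := iter n (ravg m) w.
Definition flow_test n t := \int[nu]_x (u t x * test_iter n x).

Lemma test_iterP n : test_fun nu b (test_iter n).
Proof. by elim: n => //= n; exact: test_ravg. Qed.

(** Symmetry moves Delta_m = M - 1 onto the test function, so the error in the derivative is the
    pairing of [flow_error] with [test_iter n]. *)
Lemma flow_test_derive n :
  derive_on_ge0 (flow_test n) (fun t => flow_test n.+1 t - flow_test n t).
Proof.
move=> t t0 e e0; have b0 := test_bound_ge0 tw; have tn := test_iterP n.
(* Chosen so that both terms of [L2_test_bound] are at most e/2; the added 1 keeps [lam] positive
   when b = 0. *)
pose lam := 2 * (b + 1) / e.
have lam0 : 0 < lam by rewrite divr_gt0// mulr_gt0//; lra.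
have e'0 : 0 < e / (2 * lam) by rewrite divr_gt0// mulr_gt0.
have [del del0 H] := flow_error_small t0 e'0.
exists del => // h h0 hd th; have [lE sE] := H h h0 hd th.
have ith := L2_test_integrable tn (uL2 th).
have it := L2_test_integrable tn (uL2 t0).
have [il El] := lapl_test rev tn (uL2 t0).
have id := integrableB measurableT ith it.
have Edef : \int[nu]_x (flow_error t h x * test_iter n x) =
    (flow_test n (t + h) - flow_test n t) / h - (flow_test n.+1 t - flow_test n t).
  rewrite (_ : flow_test n.+1 t = \int[nu]_x (u t x * ravg m (test_iter n) x))//.
  rewrite -El -RintegralB// mulrC -RintegralZl// -RintegralB//.
    by apply: eq_Rintegral => x _; rewrite /flow_error; ring.
  exact: (integrableZl measurableT h^-1 id).
rewrite -Edef; apply: le_trans (L2_test_bound tn lam0 lE) _.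
have : lam * sqn (flow_error t h) <= lam * (e / (2 * lam)) by rewrite ler_wpM2l// ltW.
rewrite [leRHS](_ : _ = e / 2); last by field; rewrite gt_eqF.
have : lam^-1 * b <= e / 2.
  rewrite /lam invf_div mulrAC ler_pdivrMr; last by lra.
  by nra.
rewrite /sqn; lra.
Qed.

Lemma flow_test_bounded T : exists K, forall n t, 0 <= t <= T -> `|flow_test n t| <= K.
Proof.
have [K HK] := flow_bounded T; exists (1 * K + 1^-1 * b) => n t tT.
have t0 : 0 <= t by case/andP: tT.
apply: le_trans (L2_test_bound (test_iterP n) ltr01 (uL2 t0)) _.
by rewrite lerD2r ler_wpM2l//; exact: HK.
Qed.

Lemma flow_test_vanish t : 0 < t -> {ae nu, forall x, 0 <= u0 x} ->
  \int[nu]_x (u t x * w x) <= 0 ->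
  forall n, {ae nu, forall x, u0 x * test_iter n x = 0}.
Proof.
move=> t0 u0_ge0 ut n; have [_ uu0 _] := hu.
have u00 := uL2 (lexx 0); have [mu0 _] := u00.
(* The absolute value agrees with [u0] almost everywhere and is nonnegative everywhere. *)
have lv : L2 nu (fun x => `|u 0 x|).
  split; first exact: measurableT_comp.
  by under eq_fun do rewrite real_normK ?num_real//; case: u00.
have testE k : flow_test k 0 = \int[nu]_x (`|u 0 x| * test_iter k x).
  have [mw _ _] := test_iterP k.
  congr fine; apply: ae_eq_integral => //.
  - exact/measurable_EFinP/measurable_funM.
  - apply/measurable_EFinP/measurable_funM => //; exact: measurableT_comp.
  apply: filterS2 uu0 u0_ge0 => x -> ux _ /=.
  by rewrite ger0_norm.
have test0 k : 0 <= flow_test k 0.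
  rewrite testE; apply: Rintegral_ge0 => x _; rewrite mulr_ge0//.
  by case: (test_iterP k) => _ /(_ x)/andP[].
have [K HK] := flow_test_bounded t.
have := cascade_eq0 t0 flow_test_derive HK test0 ut n.
rewrite testE => v0; have iv := L2_test_integrable (test_iterP n) lv.
have : ae_eq nu setT (EFin \o (fun x => `|u 0 x| * test_iter n x)) (cst 0%E).
  apply/ae_eq_integral_abs => //; first by case/integrableP: iv.
  rewrite (eq_integral (EFin \o (fun x => `|u 0 x| * test_iter n x))); last first.
    move=> x _; rewrite gee0_abs// lee_fin mulr_ge0//.
    by case: (test_iterP n) => _ /(_ x)/andP[].
  by rewrite -[LHS]fineK; [rewrite [fine _]v0|exact: (integrable_fin_num measurableT iv)].
apply: filterS3 uu0 u0_ge0 => x ux u0x /(_ Logic.I) [].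
by rewrite ux ger0_norm.
Qed.

End heat_flow_tests.

(** * Strict positivity *)

Section strict_positivity.
Context {R : realType} {d : measure_display} {X : measurableType d}.
Variables (m : R.-pker X ~> X) (nu : {measure set X -> \bar R}).
Hypothesis rev : reversible_measure m nu.
Variables (u0 : X -> R) (u : R -> X -> R).
Hypothesis hu : is_heat_flow m nu u0 u.
Hypothesis u0_ge0 : {ae nu, forall x, 0 <= u0 x}.

Lemma heat_flow_le0_null t (c : R) B : 0 < t -> 0 < c ->
  measurable [set x | c < u0 x] -> nu (NmD m [set x | c < u0 x]) = 0%E ->
  measurable B -> (nu B < +oo)%E -> (forall x, B x -> u t x <= 0) -> nu B = 0%E.
Proof.
move=> t0 c0; set D := [set x | c < u0 x] => mD ND0 mB Bfin uB.
have nD := nnmeas_indic (R := R) mD; have nB := nnmeas_indic (R := R) mB.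
have B1 x : ((EFin \o \1_B) x <= 1 :> \bar R)%E.
  by rewrite lee_fin indicE; case: (_ \in _).
pose w : X -> R := \1_B; pose b := fine (nu B).
have tw : test_fun nu b w.
  split; first exact: measurable_indic.
    by move=> x; rewrite /w indicE; case: (_ \in _) => /=; lra.
  by rewrite integral_indic// setIT fineK// ge0_fin_numE.
have wE n x : (test_iter m w n x)%:E = iter n (avg m) (EFin \o \1_B) x.
  elim: n x => [//|n ih] x.
  rewrite (ravgK m x (test_iterP rev tw n)) /=; apply: eq_integral => y _.
  exact: ih.
have ut : \int[nu]_x (u t x * w x) <= 0.
  have [L2u _ _] := hu; have iut := L2_test_integrable tw (L2u t (ltW t0)).
  rewrite -oppr_ge0 -mulN1r -RintegralZl//; apply: Rintegral_ge0 => x _.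
  rewrite mulN1r oppr_ge0 /w indicE; have [|_] := boolP (x \in B); last by rewrite mulr0.
  by rewrite inE => /uB; rewrite mulr1.
have van := flow_test_vanish rev hu tw t0 u0_ge0 ut.
have BD n : {ae nu, forall x, B x -> iter n (avg m) (EFin \o \1_D) x = 0%E}.
  have nDn := nnmeas_iter_avg m n nD; have nBn := nnmeas_iter_avg m n nB.
  (* By adjointness this is the integral of M^n 1_B over D, where u0 > c > 0 forces M^n 1_B to
     vanish almost everywhere. *)
  have I0 : (\int[nu]_x (iter n (avg m) (EFin \o \1_D) x * (EFin \o \1_B) x) = 0)%E.
    rewrite (iter_avg_adjoint rev n nD nB B1).
    have [mDB DB0] := nnmeasM nD nBn.
    rewrite -(integral0 nu setT); apply: ge0_ae_eq_integral => //.
    apply: filterS (van n) => x + _; rewrite -wE /= indicE.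
    have [|_] := boolP (x \in D); last by rewrite mul0e.
    rewrite inE /D /= => cu /eqP; rewrite mulf_eq0 gt_eqF ?(lt_trans c0)//=.
    by move=> /eqP ->; rewrite mule0.
  have [mDB DB0] := nnmeasM nDn nB.
  have : ae_eq nu setT (fun x => iter n (avg m) (EFin \o \1_D) x * (EFin \o \1_B) x)%E
      (cst 0%E).
    apply/ae_eq_integral_abs => //; rewrite -[RHS]I0.
    by apply: eq_integral => x _; rewrite gee0_abs.
  apply: filterS => x /(_ Logic.I) + Bx.
  by rewrite /= indicE mem_set// mule1.
have [N [mN N0 sN]] := ae_foralln BD.
have mND := measurable_NmD m mD.
apply: (subset_measure0 mB (B := NmD m D `|` N)).
- exact: measurableU.
- move=> x Bx; have [|nN] := pselect (N x); first by right.
  left => n; rewrite mstarE//; apply: contrapT => h.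
  by apply: nN; apply: sN => /= H; apply: h; exact: H.
- exact: (etrans (measureU0 mND mN N0) ND0).
Qed.

Hypothesis L2u0 : L2 nu u0.

Lemma measurable_superlevel (c : R) : measurable [set x | c < u0 x].
Proof.
have [mu0 _] := L2u0.
have -> : [set x | c < u0 x] = u0 @^-1` `]c, +oo[%classic.
  by apply/seteqP; split => x /=; rewrite in_itv/= andbT.
by rewrite -[X in measurable X]setTI; exact: mu0.
Qed.

(** Chebyshev's inequality for u0^2. *)
Lemma superlevel_finite (c : R) : 0 < c -> (nu [set x | (c < u0 x)%R] < +oo)%E.
Proof.
move=> c0; have mD := measurable_superlevel c; have [mu0 iu0] := L2u0.
have c2 : 0 < c ^+ 2 by rewrite exprn_gt0.
have : ((c ^+ 2)%:E * nu [set x | (c < u0 x)%R] < +oo)%E.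
  case/integrableP: iu0 => _; apply: le_lt_trans.
  rewrite -[X in nu X]setIT -integral_indic// -ge0_integralZl//; last 2 first.
  - by apply/measurable_EFinP; exact: measurable_indic.
  - by rewrite lee_fin ltW.
  apply: ge0_le_integral => //.
  - by move=> x _; rewrite mule_ge0// lee_fin ltW.
  - by apply: measurable_funeM; apply/measurable_EFinP; exact: measurable_indic.
  - by apply: measurableT_comp => //; exact/measurable_EFinP/measurable_funX.
  move=> x _ /=; rewrite -EFinM lee_fin ger0_norm ?sqr_ge0// indicE.
  have [|_] := boolP (_ \in _); last by rewrite mulr0 sqr_ge0.
  rewrite inE /= => cu; have u0p := lt_trans c0 cu.
  by rewrite mulr1; apply: lerXn2r; rewrite ?nnegrE; exact: ltW.
case: (nu _) => [r _||_]; [exact: ltry| |by []].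
by rewrite gt0_muley// lte_fin.
Qed.

Lemma superlevel_gt0 : ~ {ae nu, forall x, u0 x = 0} ->
  exists2 c : R, 0 < c & (0 < nu [set x | (c < u0 x)%R])%E.
Proof.
move=> u0n; apply: contrapT => H; apply: u0n.
have D0 n : {ae nu, forall x, u0 x <= n.+1%:R^-1}.
  exists [set x | n.+1%:R^-1 < u0 x]; split.
  - exact: measurable_superlevel.
  - apply/eqP; rewrite eq_le measure_ge0 andbT leNgt; apply/negP => h.
    by apply: H; exists n.+1%:R^-1.
  - by move=> x /= /negP; rewrite -ltNge.
apply: filterS2 u0_ge0 (ae_foralln D0) => x x0 xn.
apply/eqP; rewrite eq_le x0 andbT leNgt; apply/negP => xp.
(* With n the integer part of 1/u0(x), one has 1/(n+1) < u0(x). *)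
have := xn (Num.truncn (u0 x)^-1); rewrite leNgt => /negP; apply.
rewrite invf_plt ?posrE// ?ltr0n//.
exact: truncnS_gt.
Qed.

(** Sigma-finiteness cuts {u(t) <= 0} into pieces of finite measure, each null. Connectedness is
    assumed only for superlevel sets of [u0], which are open when [u0] is continuous. *)
Lemma heat_flow_gt0 t : sigma_finite setT nu -> ~ {ae nu, forall x, u0 x = 0} ->
  (forall c : R, 0 < c -> (0 < nu [set x | (c < u0 x)%R])%E ->
     (nu [set x | (c < u0 x)%R] < +oo)%E -> nu (NmD m [set x | c < u0 x]) = 0%E) ->
  0 < t -> {ae nu, forall x, 0 < u t x}.
Proof.
move=> [F FT mF] u0n ND t0; have [c c0 Dc] := superlevel_gt0 u0n.
have N0 := ND c c0 Dc (superlevel_finite c0).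
have [L2u _ _] := hu; have [mut _] := L2u t (ltW t0).
pose B n := F n `&` u t @^-1` `]-oo, 0]%classic.
have mB n : measurable (B n).
  apply: measurableI; first by case: (mF n).
  by rewrite -[X in measurable X]setTI; exact: mut.
have B0 n : nu.-negligible (B n).
  apply/negligibleP => //.
  apply: (heat_flow_le0_null t0 c0 (measurable_superlevel c) N0 (mB n)).
    have [mFn Fn] := mF n.
    by apply: le_lt_trans Fn; apply: le_measure; rewrite ?inE//; exact: subIsetl.
  by move=> x [_] /=; rewrite in_itv.
have [N [mN NN sN]] := negligible_bigcup B0.
exists N; split => // x /= /negP; rewrite -leNgt => ux; apply: sN.
have [n _ Fx] : (\bigcup_n F n) x by rewrite -FT.
by exists n => //; split => //=; rewrite in_itv.
Qed.

End strict_positivity.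

Theorem theorem2p9 (R : realType) (d : measure_display) (X : measurableType d)
  (dist : X -> X -> R) (m : R.-pker X ~> X) (nu : {measure set X -> \bar R}) :
  metric_rw_space dist m -> sigma_finite setT nu -> radon dist nu ->
  invariant_measure m nu -> reversible_measure m nu ->
  (m_connected m nu <-> heat_positivity m nu (fun _ => True)) /\
  (weakly_m_connected dist m nu <-> heat_positivity m nu (dcontinuous dist)).
Proof.
move=> [[metric _ _] bo _] sf _ _ rev; split; split.
- move=> conn u0 L2u0 _ u0_ge0 u0n u hu t t0.
  apply: (heat_flow_gt0 rev hu u0_ge0 L2u0 sf u0n _ t0) => c c0.
  by apply: conn; exact: measurable_superlevel L2u0 c.
- move=> hp D mD D0 Dfin.
  apply: (heat_positivity_NmD rev hp mD D0 Dfin (g := \1_D)) => //.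
  + by move=> x; rewrite lexx indicE ler0n.
  + by move=> x Dx; rewrite indicE mem_set.
- move=> conn u0 L2u0 cu0 u0_ge0 u0n u hu t t0.
  apply: (heat_flow_gt0 rev hu u0_ge0 L2u0 sf u0n _ t0) => c c0.
  by apply: conn; exact: dopen_dcontinuous_gt.
- move=> hp D oD D0 Dfin; have [g [cg g01 gD]] := dopen_cutoff metric oD.
  apply: (heat_positivity_NmD rev hp _ D0 Dfin _ g01 gD cg).
  + exact: dopen_measurable bo oD.
  + exact: dcontinuous_measurable bo cg.
Qed.
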